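(* Let $T^n=\mathbb{R}^n/\Lambda_n$ be a flat $n$-torus admitting a minimal isometric immersion into some sphere $\mathbb{S}^m$. Let $(q_{ij})$ be the Gram matrix of $\Lambda_n$ and let $K$ be the field extension of $\mathbb{Q}$ generated by all ratios $q_{ij}/q_{11}$, $1\le i,j\le n$. Then $$[K:\mathbb{Q}]\leq (n-1)^{\left\lfloor \frac{(n-1)(n+2)}{4}\right\rfloor},$$ where $\lfloor\cdot\rfloor$ denotes the integer part of a real number.
   Context: A flat $n$-torus is $\mathbb{R}^n/\Lambda_n$ with the flat metric induced from the Euclidean metric, where $\Lambda_n\subset\mathbb{R}^n$ is a lattice of rank $n$. If the rows of $L_n$ form a basis of $\Lambda_n$, the Gram matrix of $\Lambda_n$ is $L_nL_n^t$. Spheres are unit round spheres $\mathbb{S}^m\subset\mathbb{R}^{m+1}$. *)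

(* Defs.v *)
From HB Require Import structures.
From mathcomp Require Import all_boot all_order all_algebra all_field.
From mathcomp Require Import generic_quotient.
From mathcomp Require Import all_classical all_reals all_analysis.
Import Order.TTheory GRing.Theory Num.Theory.
Import numFieldNormedType.Exports.

Set Implicit Arguments.
Unset Strict Implicit.
Unset Printing Implicit Defensive.

Local Open Scope classical_set_scope.
Local Open Scope ring_scope.
Local Open Scope quotient_scope.

(* The library's norm on ['rV[R]_n] is the sup norm; it is used only through
   its topology, and the Euclidean structure is [dot]. *)
Definition dot (R : realType) (n : nat) (u v : 'rV[R]_n) : R :=
  (u *m v^T) 0 0.

Definition lattice (R : realType) (n : nat) (L : 'M[R]_n) : set 'rV[R]_n :=
  [set map_mx intr k *m L | k in [set: 'rV[int]_n]].

Definition gram (R : realType) (n : nat) (L : 'M[R]_n) : 'M[R]_n :=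
  L *m L^T.

Section Torus.
Variables (R : realType) (n : nat) (L : 'M[R]_n).

Definition lattice_rel : rel 'rV[R]_n := fun x y => x - y \in lattice L.

Lemma lattice_rel_refl : reflexive lattice_rel.
Proof.
move=> x; apply/mem_set; exists 0 => //.
by rewrite map_mx0 mul0mx subrr.
Qed.

Lemma lattice_rel_sym : symmetric lattice_rel.
Proof.
suff S x y : lattice_rel x y -> lattice_rel y x by move=> x y; apply/idP/idP; exact: S.
move=> /set_mem[k _ Hk]; apply/mem_set; exists (- k) => //.
by rewrite map_mxN mulNmx Hk opprB.
Qed.

Lemma lattice_rel_trans : transitive lattice_rel.
Proof.
move=> y x z /set_mem[k _ Hk] /set_mem[l _ Hl]; apply/mem_set.
exists (k + l) => //.
by rewrite map_mxD mulmxDl Hk Hl addrA subrK.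
Qed.

Canonical lattice_equiv :=
  EquivRel lattice_rel lattice_rel_refl lattice_rel_sym lattice_rel_trans.

Definition torus : Type := {eq_quot lattice_equiv}.

Definition torus_proj (x : 'rV[R]_n) : torus := \pi_({eq_quot lattice_equiv}) x.

End Torus.

Section Maps.
Variables (R : realType) (n k : nat).
Implicit Types F : 'rV[R]_n -> 'rV[R]_k.

Definition partial (i : 'I_n) F : 'rV[R]_n -> 'rV[R]_k :=
  fun x => 'D_(delta_mx 0 i) F x.

Fixpoint Ck (r : nat) F : Prop :=
  if r is r'.+1 then
    (forall x, differentiable F x) /\ (forall i, Ck r' (partial i F))
  else continuous F.

Definition smooth F : Prop := forall r, Ck r F.

Definition isometric F : Prop :=
  forall x u v : 'rV[R]_n, dot ('D_u F x) ('D_v F x) = dot u v.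

(* When [F] is isometric with values in the unit sphere, the vectors [F x] and
   [partial j F x] are orthonormal, so this is the orthogonal projection onto
   the normal space at [F x] of the immersion into the sphere. *)
Definition normal_part F (x : 'rV[R]_n) (w : 'rV[R]_k) : 'rV[R]_k :=
  w - dot w (F x) *: F x
    - \sum_(j < n) dot w (partial j F x) *: partial j F x.

(* The Levi-Civita connection of the sphere differs from the ambient derivative
   by a multiple of [F x], which [normal_part] removes. *)
Definition second_fundamental_form F (i j : 'I_n) (x : 'rV[R]_n) : 'rV[R]_k :=
  normal_part F x (partial i (partial j F) x).

(* The pulled-back metric is the identity in the coordinates of R^n, so the
   trace is the plain sum over [i]. *)
Definition mean_curvature F (x : 'rV[R]_n) : 'rV[R]_k :=
  n%:R^-1 *: \sum_(i < n) second_fundamental_form F i i x.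

End Maps.

(* The projection R^n -> R^n / Lambda is a local diffeomorphism and, by
   definition of the flat metric, a local isometry; hence the differential
   conditions on [f] are conditions on its lift to R^n. *)
Definition minimal_isometric_immersion (R : realType) (n m : nat)
    (L : 'M[R]_n) (f : torus L -> 'rV[R]_m.+1) : Prop :=
  let F := fun x => f (torus_proj L x) in
  [/\ forall p, dot (f p) (f p) = 1,
      smooth F,
      isometric F &
      forall x, mean_curvature F x = 0].

Definition generated_subfield (R : realType) (A : set R) : set R :=
  [set x | forall S : {pred R},
     divring_closed S -> (forall a, A a -> a \in S) -> x \in S].

Definition has_degree (R : realType) (K : set R) (d : nat) : Prop :=
  exists (E : fieldExtType rat) (iota : {rmorphism E -> R}),
    range iota = K /\ \dim {: E} = d.

(* Main.v *)
(* Let F be the lift of the immersion and q the Gram matrix. By Takahashi's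
   theorem F is an eigenfunction of the Laplacian with eigenvalue n, so its
   frequencies are the dual lattice vectors of norm n ^ (1/2); in lattice
   coordinates they are the integer vectors k with k P k^T = 1, where
   P = Q^-1 and Q = n / (2 pi)^2 q. A constant coefficient second order
   operator whose symbol vanishes at all these k kills F; taking the inner
   product with F shows that Q lies in the span of the matrices k^T k.

   So Q is a critical point of det on the rational affine hull of the matrices
   n k^T k, and dually P is one on the rational affine space of symmetric X
   with k X k^T = 1. The dimensions of these two spaces add up to at most
   n (n + 1) / 2 - 1 = (n - 1) (n + 2) / 2, so one of them has dimension
   e <= (n - 1) (n + 2) / 4.

   By strict concavity of log det the critical point x is a strict local
   maximum of det, hence a limit of critical points x_t of
   det + t / n * \sum_i x_i ^ n, i.e. of solutions of
   t x_i ^ (n - 1) + (d det / d x_i) (x) = 0. Modulo these relations the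
   monomials with all exponents < n - 1 span over rat(t), so any
   (n - 1) ^ e + 1 polynomials in x_t are dependent over rat[t]; a relation
   whose coefficients do not all vanish at t = 0 survives in the limit. Hence
   rat[x] is a field of degree at most (n - 1) ^ e. *)

Require Import Defs.
From HB Require Import structures.
From mathcomp Require Import all_boot all_order all_algebra all_field.
From mathcomp Require Import fraction generic_quotient perm complex.
From mathcomp Require Import all_classical all_reals all_analysis.
From mathcomp Require Import zify ring lra.
Import Order.TTheory GRing.Theory Num.Theory.
Import numFieldNormedType.Exports.

Set Implicit Arguments.
Unset Strict Implicit.
Unset Printing Implicit Defensive.

Local Open Scope classical_set_scope.
Local Open Scope ring_scope.

(** * Fields of bounded degree over the rationals *)

(** The obstacle is that the complex solutions of d det / d x_i = 0 can form sets of positive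
    dimension: all partial derivatives vanish wherever the corank is at least 2. So Bezout's theorem
    gives no bound directly, although the real critical point is isolated. The perturbing term is
    chosen for its derivatives: the new relations have leading forms t x_i ^ (n - 1), which have no
    common zero at infinity and reduce every monomial by division. A perturbation may destroy a
    critical point but not a strict local maximum, and this is why concavity enters.

    Criticality comes from the derivative of det at Q in direction N, which is det Q tr (P N): for
    two frequencies k, l, tr (P (k^T k - l^T l)) = 1 - 1 = 0. Dually, Q annihilates every symmetric
    N with k N k^T = 0 for all frequencies k, because it lies in the span of the k^T k.

    The Fourier analysis is done with averages over finite grids instead of integrals. Only the
    vanishing of limits is ever asserted, so no Fourier coefficient has to be shown to exist. *)

Section RationalSpan.
Variable R : numFieldType.
Implicit Types (y z : R) (p q r : {poly rat}) (K : {pred R}).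
Local Notation "p ^ratr" := (map_poly (ratr : rat -> R) p) (at level 2).

Definition rat_dependent m (y : 'I_m -> R) : Prop :=
  exists2 c : 'rV[rat]_m, c != 0 & \sum_i ratr (c 0 i) * y i = 0.

Lemma rat_dependent_powers m y :
  rat_dependent (fun i : 'I_m => y ^+ i) ->
  exists p, [/\ p != 0, (size p <= m)%N & root p^ratr y].
Proof.
move=> [c c0 Hc]; exists (rVpoly c); split; last 1 first.
- rewrite rootE (@horner_coef_wide _ m) ?size_map_poly ?size_poly //.
  rewrite -[X in _ == X]Hc; apply/eqP/eq_bigr => i _.
  by rewrite coef_map /= coef_rVpoly_ord.
- by apply: contra_neq c0 => p0; rewrite -[c]rVpolyK p0 linear0.
- exact: size_poly.
Qed.

Lemma min_ratpoly y p : p != 0 -> root p^ratr y ->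
  exists q, [/\ q != 0, root q^ratr y &
    forall r, root r^ratr y -> r != 0 -> (size q <= size r)%N].
Proof.
move=> p0 py.
have ex : exists k, `[< exists q, [/\ q != 0, root q^ratr y & size q = k] >].
  by exists (size p); apply/asboolP; exists p.
case: (ex_minnP ex) => k /asboolP[q [q0 qy <-]] kmin.
by exists q; split=> // r ry r0; apply: kmin; apply/asboolP; exists r.
Qed.

Lemma horner_ratr_closed K z p :
  divring_closed K -> z \in K -> p^ratr.[z] \in K.
Proof.
move=> /[dup] clK [K1 KB KV] zK.
have K0 : 0 \in K by rewrite -(subrr 1) KB.
have KN x : x \in K -> - x \in K by move=> xK; rewrite -sub0r KB.
have KD x y : x \in K -> y \in K -> x + y \in K.
  by move=> xK yK; rewrite -[y]opprK KB ?KN.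
have KM x y : x \in K -> y \in K -> x * y \in K.
  by move=> xK yK; rewrite -[y]invrK KV // -div1r KV.
have Kn (m : nat) : m%:R \in K.
  by elim: m => [//|m IH]; rewrite -addn1 natrD KD.
have Kz (m : int) : m%:~R \in K.
  by case: m => m; rewrite ?NegzE ?mulrNz ?KN ?Kn.
have Kq (a : rat) : ratr a \in K by rewrite /ratr KV.
elim/poly_ind: p => [|p c IH].
  by rewrite rmorph0 horner0.
rewrite rmorphD rmorphM /= map_polyX map_polyC /= hornerMXaddC; apply: KD; first exact: KM.
exact: Kq.
Qed.

(** Induction on [s]: the primitive element theorem in characteristic 0 merges a generator for the
    tail with the new element, both being algebraic over the rationals. *)
Lemma primitive_element K (s : seq R) :
  divring_closed K -> {subset s <= K} ->
  (forall y, y \in K -> exists2 p, p != 0 & root p^ratr y) ->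
  exists2 z, z \in K & forall a, a \in s -> exists p, p^ratr.[z] = a.
Proof.
move=> clK sK alg; elim: s sK => [|a s IH] sK.
  by have [K1 _ _] := clK; exists 1.
have [|z zK Hz] := IH; first by move=> x xs; apply: sK; rewrite inE xs orbT.
have aK : a \in K by apply: sK; rewrite mem_head.
have [p p0 pz] := alg _ zK; have [q q0 qa] := alg _ aK.
have [k [[pz' Hpz] [pa Hpa]]] := pchar0_PET p0 pz q0 qa (@pchar_num rat).
set w := a *+ k - z in Hpz Hpa.
have [K1 KB KV] := clK.
have wK : w \in K.
  rewrite KB // -mulr_natr -[_%:R]invrK KV // -div1r KV //.
  by have := @horner_ratr_closed K 1 k%:R%:P clK K1; rewrite map_polyC hornerC /= ratr_nat.
exists w => // b; rewrite inE => /predU1P[->|/Hz[r <-]]; first by exists pa.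
by exists (r \Po pz'); rewrite map_comp_poly horner_comp Hpz.
Qed.

(** A primitive element [z] generates [K], and the degree of its minimal polynomial is at most [m]
    because its first [m.+1] powers are dependent. [E] is the ring of rational polynomials modulo
    that minimal polynomial. *)
Lemma finite_extension K m (s : seq R) :
  divring_closed K -> {subset s <= K} ->
  (forall K', divring_closed K' -> {subset s <= K'} -> {subset K <= K'}) ->
  (forall y : 'I_m.+1 -> R, (forall i, y i \in K) -> rat_dependent y) ->
  exists (E : fieldExtType rat) (iota : {rmorphism E -> R}),
    (forall y, y \in K <-> exists e, iota e = y) /\ (\dim {: E} <= m)%N.
Proof.
move=> clK sK Kmin Kdep; have [K1 KB KV] := clK.
have KX y i : y \in K -> y ^+ i \in K.
  by move=> yK; have := horner_ratr_closed 'X^i clK yK; rewrite map_polyXn hornerXn.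
have alg y : y \in K -> exists2 p, p != 0 & root p^ratr y.
  move=> yK; have [|p [p0 _ py]] := @rat_dependent_powers m.+1 y; last by exists p.
  by apply: Kdep => i; apply: KX.
have [z zK Hz] := primitive_element clK sK alg.
have [p0 p00 p0z] := alg _ zK.
have [p [pn0 pz /(subfx_irreducibleP pz pn0) irr_p]] := min_ratpoly p00 p0z.
pose E := SubFieldExtType pz irr_p.
pose iota : {rmorphism E -> R} := @subfx_inj _ _ ratr z p.
have iotaE q : iota (subfx_eval _ z p q) = q^ratr.[z] by exact: subfx_inj_eval.
exists E, iota; split=> [y|].
  split=> [yK|[e <-]]; last first.
    by have [q ->] := subfxE e; rewrite iotaE; exact: horner_ratr_closed.
  pose K' : {pred R} := fun y => `[< exists e, iota e = y >].
  suff /asboolP : y \in K' by [].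
  apply: Kmin yK => [|a /Hz[q qza]]; last first.
    by apply/asboolP; exists (subfx_eval _ z p q); rewrite iotaE.
  split; first by apply/asboolP; exists 1; rewrite rmorph1.
    move=> _ _ /asboolP[a <-] /asboolP[b <-].
    by apply/asboolP; exists (a - b); rewrite rmorphB.
  move=> _ _ /asboolP[a <-] /asboolP[b <-].
  by apply/asboolP; exists (a / b); rewrite fmorph_div.
rewrite dimvf /dim /=.
have [|q [q0 qm qz]] := @rat_dependent_powers m.+1 z.
  by apply: Kdep => i; apply: KX.
have := (@subfx_irreducibleP _ _ ratr z p pz pn0).2 irr_p q qz q0.
by move=> /leq_trans/(_ qm); rewrite polySpred.
Qed.

End RationalSpan.

Lemma fraction_numden (P : idomainType) (x : {fraction P}) :
  exists n d : P, d != 0 /\ x * FracField.tofrac d = FracField.tofrac n.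
Proof.
elim/quotW: x => r; exists (frac r).1, (frac r).2; split; first exact: denom_ratioP.
unlock FracField.tofrac; rewrite -[_ * _]FracField.pi_mul; apply/eqmodP => /=.
rewrite FracField.equivfE /FracField.mulf /= !numden_Ratio
  ?mulf_neq0 ?oner_neq0 ?denom_ratioP //.
by rewrite !mulr1 mulrC.
Qed.

(** A kernel vector exists over the fraction field; multiplying it by the product of its
    denominators brings it back to [P]. *)
Lemma wide_left_kernel (P : idomainType) m k (A : 'M[P]_(m, k)) :
  (k < m)%N -> exists2 c : 'rV[P]_m, c != 0 & c *m A = 0.
Proof.
move=> km; have [fr frI frE] : exists2 fr : {rmorphism P -> {fraction P}},
    injective fr & fr =1 @FracField.tofrac P.
  by exists (@FracField.tofrac P) => // a b /eqP; rewrite tofrac_eq => /eqP.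
pose B := map_mx fr A; have /rowV0Pn[v /sub_kermxP vB v0] : kermx B != 0.
  by rewrite -mxrank_eq0 mxrank_ker subn_eq0 -ltnNge (leq_ltn_trans (rank_leq_col _)).
have /choice[nd Hnd] (j : 'I_m) : exists nd : P * P, nd.2 != 0 /\ v 0 j * fr nd.2 = fr nd.1.
  by have [a [b Hab]] := fraction_numden (v 0 j); exists (a, b); rewrite !frE.
pose d := \prod_j (nd j).2.
have d0 : d != 0 by apply/prodf_neq0 => j _; have [] := Hnd j.
pose c := \row_j ((nd j).1 * \prod_(i | i != j) (nd i).2).
have cE : map_mx fr c = fr d *: v.
  apply/rowP => j; rewrite !mxE.
  have -> : d = (nd j).2 * \prod_(i | i != j) (nd i).2 by rewrite /d (bigD1 j).
  by rewrite !rmorphM -(Hnd j).2 [RHS]mulrC mulrA.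
exists c.
  apply: contra_neq v0 => c0; move: cE; rewrite c0 map_mx0 => /esym/eqP.
  by rewrite scaler_eq0 -(rmorph0 fr) (inj_eq frI) (negPf d0) /= => /eqP.
have : map_mx fr (c *m A) = 0 by rewrite map_mxM cE -scalemxAl -/B vB scaler0.
by move/matrixP => H; apply/matrixP => i j; apply: frI; have := H i j; rewrite !mxE rmorph0.
Qed.

(** As long as all entries of a kernel vector vanish at 0, a factor ['X] can be divided out, which
    lowers the size of a nonzero entry. The vector reached in the end specializes at 0 to a
    nontrivial one. *)
Lemma wide_left_kernel_at0 (F : fieldType) m k (A : 'M[{poly F}]_(m, k)) :
  (k < m)%N ->
  exists2 c : 'rV[{poly F}]_m, exists j, (c 0 j).[0] != 0 & c *m A = 0.
Proof.
move=> /wide_left_kernel - /(_ _ A)[c] /rV0Pn[j].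
have [N] := ubnP (size (c 0 j)); elim: N => // N IH in c *; rewrite ltnS => cN cj cA.
case: (boolP [exists i, (c 0 i).[0] != 0]) => [/existsP[i ci]|/existsPn c0].
  by exists c => //; exists i.
pose c' := \row_i (c 0 i %/ 'X).
have cE : c = 'X *: c'.
  apply/rowP => i; rewrite !mxE mulrC divpK //.
  by have := c0 i; rewrite negbK -[_ == 0]/(root _ 0) root_factor_theorem subr0.
have X0 : ('X : {poly F}) != 0 by rewrite polyX_eq0.
have c'j : c' 0 j != 0 by apply: contra_neq cj => c0j; rewrite cE mxE c0j mulr0.
apply: (IH c' _ c'j).
  have cjE : c 0 j = c' 0 j * 'X by rewrite cE mxE mulrC.
  by apply: leq_trans cN; rewrite cjE size_mulX.
by apply/eqP; move/eqP: cA; rewrite cE -scalemxAl scalemx_eq0 (negPf X0).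
Qed.

(** * Rational forms and elimination *)

Section Forms.
Variables (R : numFieldType) (s : nat).
Local Notation I := ('I_s.+1).
Implicit Types (X : I -> R) (g : (I -> R) -> R).

Definition monomial X (w : seq I) : R := \prod_(i <- w) X i.

(* Rational homogeneous forms of degree [D], as lists of (coefficient, word).
   The variable [X ord0] is set to 1 later on, so they also encode the
   polynomials of degree at most [D] in the other variables. *)
Definition ratform (D : nat) g : Prop :=
  exists2 l : seq (rat * seq I), all (fun p => size p.2 == D) l &
    forall X, g X = \sum_(p <- l) ratr p.1 * monomial X p.2.

Lemma ratform_ext D g g' : g =1 g' -> ratform D g -> ratform D g'.
Proof. by move=> E [l lD H]; exists l => // X; rewrite -E. Qed.

Lemma ratform_cst (a : rat) : ratform 0 (fun=> ratr a).
Proof.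
by exists [:: (a, [::])] => // X; rewrite big_seq1 /monomial big_nil mulr1.
Qed.

Lemma ratform_monomial w : ratform (size w) (monomial^~ w).
Proof.
by exists [:: (1, w)] => [|X]; rewrite /= ?eqxx // big_seq1 rmorph1 mul1r.
Qed.

Lemma ratform_var i : ratform 1 (fun X => X i).
Proof.
apply: ratform_ext (ratform_monomial [:: i]) => X.
by rewrite /monomial big_seq1.
Qed.

Lemma ratformD D g h :
  ratform D g -> ratform D h -> ratform D (fun X => g X + h X).
Proof.
move=> [l lD Hl] [k kD Hk]; exists (l ++ k); first by rewrite all_cat lD.
by move=> X; rewrite big_cat Hl Hk.
Qed.

Lemma ratformM D D' g h :
  ratform D g -> ratform D' h -> ratform (D + D') (fun X => g X * h X).
Proof.
move=> [l lD Hl] [k kD Hk].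
exists [seq (p.1 * q.1, p.2 ++ q.2) | p <- l, q <- k].
  apply/allP => _ /allpairsP[[p q] [pl qk ->]] /=.
  by rewrite size_cat (eqP (allP lD _ pl)) (eqP (allP kD _ qk)).
move=> X; rewrite Hl Hk big_distrlr big_allpairs_dep /=.
apply: eq_bigr => p _; apply: eq_bigr => q _.
by rewrite rmorphM /monomial big_cat /= mulrACA.
Qed.

Lemma ratformZ D a g : ratform D g -> ratform D (fun X => ratr a * g X).
Proof. exact: (ratformM (ratform_cst a)). Qed.

Lemma ratform0 D : ratform D (fun=> 0).
Proof. by exists [::] => // X; rewrite big_nil. Qed.

Lemma ratform_sum (J : Type) (r : seq J) D (g : J -> (I -> R) -> R) :
  (forall j, ratform D (g j)) -> ratform D (fun X => \sum_(j <- r) g j X).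
Proof.
move=> Hg; elim: r => [|j r IH].
  by apply: ratform_ext (ratform0 D) => X; rewrite big_nil.
by apply: ratform_ext (ratformD (Hg j) IH) => X; rewrite big_cons.
Qed.

Lemma ratform_prod (J : Type) (r : seq J) (g : J -> (I -> R) -> R) :
  (forall j, ratform 1 (g j)) ->
  ratform (size r) (fun X => \prod_(j <- r) g j X).
Proof.
move=> Hg; elim: r => [|j r IH].
  by apply: ratform_ext (ratform_cst 1) => X; rewrite big_nil rmorph1.
by apply: ratform_ext (ratformM (Hg j) IH) => X; rewrite big_cons.
Qed.

(** Padding with powers of [X ord0] raises the degree without changing values on the chart
    [X ord0 = 1]. *)
Lemma ratform_raise D k g : ratform D g ->
  exists2 h, ratform (D + k) h & forall X, X ord0 = 1 -> h X = g X.
Proof.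
move=> Hg; exists (fun X => g X * monomial X (nseq k ord0)).
  by apply: ratformM; rewrite // -[k in ratform k _](size_nseq k (ord0 : I));
    exact: ratform_monomial.
move=> X X0; rewrite /monomial big1_seq ?mulr1 // => i /andP[_].
by rewrite mem_nseq => /andP[_ /eqP->].
Qed.

Lemma ratform_coef D g : ratform D g ->
  exists c : D.-tuple I -> rat, forall X, g X = \sum_w ratr (c w) * monomial X w.
Proof.
case=> l lD Hl; exists (fun w : D.-tuple I => \sum_(p <- l | p.2 == w :> seq I) p.1) => X.
rewrite Hl; transitivity (\sum_(p <- l)
    \sum_(w : D.-tuple I | p.2 == w :> seq I) ratr p.1 * monomial X w).
  rewrite !big_seq; apply: eq_bigr => p /(allP lD) pD.
  by rewrite (big_pred1 (Tuple pD)) //= => w; rewrite [RHS]eq_sym.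
rewrite (exchange_big_dep xpredT) //=; apply: eq_bigr => w _.
by rewrite rmorph_sum /= mulr_suml.
Qed.

Definition box_monomial d X (b : {ffun 'I_s -> 'I_d}) : R :=
  \prod_i X (lift ord0 i) ^+ b i.

Lemma monomial_counts X w :
  monomial X w = \prod_i X i ^+ count_mem i w.
Proof.
elim: w => [|j w IH]; first by rewrite /monomial big_nil big1.
rewrite /monomial big_cons -/(monomial X w) IH /=.
rewrite [RHS](bigD1 j) //= eqxx exprD expr1 -mulrA; congr (_ * _).
rewrite (bigD1 j) //=; congr (_ * _).
by apply: eq_bigr => i /negPf ij; rewrite eq_sym ij.
Qed.

(* Multiplication by [t] in the algebra with relations
   [t * X_i ^ d = - f_i X], whose box monomials have all exponents < d. *)
Lemma word_reduction d D (f : 'I_s -> (I -> R) -> R) (w : D.-tuple I) :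
  (forall i, ratform d (f i)) ->
  exists ce : ({ffun 'I_s -> 'I_d} -> rat) * (D.-tuple I -> rat),
  forall X t, X ord0 = 1 ->
    (forall i, t * X (lift ord0 i) ^+ d = - f i X) ->
    t * monomial X w = t * (\sum_b ratr (ce.1 b) * box_monomial X b)
                     - \sum_v ratr (ce.2 v) * monomial X v.
Proof.
move=> Hf; have [/existsP[i di]|/existsPn small] :=
    boolP [exists i, (d <= count_mem (lift ord0 i) w)%N].
- set j := lift ord0 i in di *.
  (* Trading [d] occurrences of [j] for the form [f i] keeps the total degree [D], so the result is
     again a combination of words of length [D] and the linear system closes up. *)
  pose w' := nseq (count_mem j w - d) j ++ [seq x <- w | x != j].
  have pw : perm_eq w (nseq d j ++ w').
    rewrite /w' catA -nseqD subnKC //.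
    have <- : [seq x <- w | pred1 j x] = nseq (count_mem j w) j.
      by rewrite -size_filter; apply/all_pred1P/filter_all.
    by rewrite perm_sym perm_filterC.
  have sw' : (d + size w' = D)%N.
    by have := perm_size pw; rewrite size_tuple size_cat size_nseq => <-.
  have /ratform_coef[c Hc] : ratform D (fun X => f i X * monomial X w').
    by rewrite -sw'; apply: ratformM => //; exact: ratform_monomial.
  exists (fun=> 0, c) => X t X0 HX.
  rewrite big1 => [|b _]; last by rewrite /= rmorph0 mul0r.
  rewrite mulr0 sub0r /= -Hc /monomial (perm_big _ pw) big_cat /= big_nseq.
  by rewrite iter_mulr_1 mulrA HX mulNr.
have small' i : (count_mem (lift ord0 i) w < d)%N by rewrite ltnNge small.
pose b := [ffun i => Ordinal (small' i)].
exists (fun b' => (b' == b)%:R, fun=> 0) => X t X0 _.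
rewrite [X in _ - X]big1 => [|v _]; last by rewrite /= rmorph0 mul0r.
rewrite subr0 (bigD1 b) //= eqxx rmorph1 mul1r big1 => [|b' /negPf->]; last first.
  by rewrite rmorph0 mul0r.
rewrite addr0 monomial_counts big_ord_recl X0 expr1n mul1r.
by congr (_ * _); apply: eq_bigr => i _; rewrite ffunE.
Qed.

End Forms.

Lemma sum_enum_val (V : nmodType) (T : finType) (F : T -> V) :
  \sum_w F w = \sum_(a < #|T|) F (enum_val a).
Proof. exact: big_enum_val. Qed.

Lemma cvg_bigsum (R : realType) (T J : Type) (F : set_system T) {FF : Filter F}
    (r : seq J) (u : J -> T -> R) (a : J -> R) :
  (forall j, u j @ F --> a j) ->
  (fun k => \sum_(j <- r) u j k) @ F --> \sum_(j <- r) a j.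
Proof.
move=> Hu; elim: r => [|j r IH].
  by under eq_fun do rewrite big_nil; rewrite big_nil; exact: cvg_cst.
by under eq_fun do rewrite big_cons; rewrite big_cons; exact: cvgD.
Qed.

Lemma continuous_bigsum (R : realType) (T : topologicalType) (J : Type)
    (r : seq J) (u : J -> T -> R) :
  (forall j, continuous (u j)) -> continuous (fun x => \sum_(j <- r) u j x).
Proof. by move=> Hu x; apply: (@cvg_bigsum _ _ _ (nbhs x)) => j; exact: Hu. Qed.

Lemma continuous_mul (R : realType) (T : topologicalType) (u v : T -> R) :
  continuous u -> continuous v -> continuous (fun x => u x * v x).
Proof. by move=> uC vC x; exact: cvgM (uC x) (vC x). Qed.

Lemma continuous_bigprod (R : realType) (T : topologicalType) (J : Type)
    (r : seq J) (u : J -> T -> R) :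
  (forall j, continuous (u j)) -> continuous (fun x => \prod_(j <- r) u j x).
Proof.
move=> Hu; elim: r => [|j r IH].
  by under eq_fun do rewrite big_nil; exact: cst_continuous.
by under eq_fun do rewrite big_cons; exact: continuous_mul.
Qed.

Lemma cvg_seq_unique (R : realType) (u : nat -> R) (a b : R) :
  u @ \oo --> a -> u @ \oo --> b -> a = b.
Proof.
by move=> /(cvg_lim (@norm_hausdorff _ _)) <- /(cvg_lim (@norm_hausdorff _ _)) <-.
Qed.

(** * Relations that survive the limit t -> 0 *)

Section Limit.
Variables (R : realType) (s d : nat) (f : 'I_s -> ('I_s.+1 -> R) -> R).
Hypothesis f_form : forall i, ratform d (f i).
Variables (x : nat -> 'I_s.+1 -> R) (t : nat -> R) (xl : 'I_s.+1 -> R).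
Hypothesis x0 : forall j, x j ord0 = 1.
Hypothesis t_neq0 : forall j, t j != 0.
Hypothesis t_cvg : t @ \oo --> (0 : R).
Hypothesis x_cvg : forall i, (fun j => x j i) @ \oo --> xl i.
Hypothesis x_eq : forall j i, t j * x j (lift ord0 i) ^+ d = - f i (x j).
Local Notation I := 'I_s.+1.
Local Notation ratr := (ratr : rat -> R).

Lemma cvg_monomial (w : seq I) : (fun j => monomial (x j) w) @ \oo --> monomial xl w.
Proof. by apply: (cvg_big (@mul_continuous R)) => i _; exact: x_cvg. Qed.

Lemma cvg_ratform D g : ratform D g -> (fun j => g (x j)) @ \oo --> g xl.
Proof.
move=> [l _ Hl]; rewrite Hl; under eq_fun do rewrite Hl.
apply: cvg_bigsum => i.
by apply: cvgM; [exact: cvg_cst|exact: cvg_monomial].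
Qed.

Lemma cvg_horner (p : {poly R}) : (fun j => p.[t j]) @ \oo --> p.[0].
Proof. by apply: (cvg_comp _ _ t_cvg); exact: continuous_horner. Qed.

(** Split off the power of ['X] dividing [p]: the cofactor is nonzero at 0, hence near 0, and the
    power is nonzero because [t j] is. *)
Lemma near_horner_neq0 (p : {poly R}) : p != 0 ->
  \forall j \near \oo, p.[t j] != 0.
Proof.
move=> p0; have [m [q + pE]] := multiplicity_XsubC p 0.
rewrite p0 /= rootE => q0.
have : \forall j \near \oo, q.[t j] != 0.
  exact: cvgr_neq0 (@cvg_horner q) q0.
apply: filterS => j qj; rewrite pE subr0 hornerM hornerXn mulf_neq0 //.
by rewrite expf_neq0 // t_neq0.
Qed.

(* If m and b are the vectors of all words and of all box monomials, reduction
   reads (t + E) m = t C b, so that det (t + E) m = t adj (t + E) C b. *)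
Lemma limit_dependent (g : 'I_(d ^ s).+1 -> (I -> R) -> R) :
  (forall p, exists D, ratform D (g p)) -> rat_dependent (fun p => g p xl).
Proof.
(* A common degree for all the [g p], so that one set of words serves for all of them. *)
move=> /choice[deg Hg]; pose D := (\sum_p deg p)%N.
have /choice[h Hh] p : exists h, ratform D h /\ forall X, X ord0 = 1 -> h X = g p X.
  have [h hD hE] := ratform_raise (D - deg p)%N (Hg p); exists h; split=> //.
  by rewrite subnKC // in hD; rewrite /D (bigD1 p) //= leq_addr.
have xl0 : xl ord0 = 1.
  apply: (cvg_seq_unique (@x_cvg ord0)).
  by under eq_fun do rewrite x0; exact: cvg_cst.
pose T : finType := D.-tuple I.
pose B : finType := {ffun 'I_s -> 'I_d}.
have cardB : #|B| = (d ^ s)%N by rewrite card_ffun !card_ord.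
have /choice[z Hz] p : exists c : T -> rat,
    forall X, h p X = \sum_w ratr (c w) * monomial X w.
  by have /ratform_coef := (Hh p).1.
have /choice[ce Hce] (w : T) := word_reduction w f_form.
pose E : 'M[rat]_#|T| := \matrix_(a, b) (ce (enum_val a)).2 (enum_val b).
pose C : 'M[rat]_(#|T|, #|B|) := \matrix_(a, b) (ce (enum_val a)).1 (enum_val b).
pose Z : 'M[rat]_((d ^ s).+1, #|T|) := \matrix_(p, a) z p (enum_val a).
(* This is ['X + E]. Its determinant is a characteristic polynomial, monic and hence nonzero even
   when [E] is singular. *)
pose A : 'M[{poly rat}]_#|T| := char_poly_mx (- E).
(* There are [d ^ s] columns, one for each box monomial, and one more row; a single [c] annihilates
   the box monomials for all values of [t] at once. *)
have [|c [p cp] cW] :=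
  @wide_left_kernel_at0 rat _ _ (map_mx polyC Z *m \adj A *m map_mx polyC C).
  by rewrite cardB.
pose mv X : 'cV[R]_#|T| := \col_a monomial X (enum_val a : T).
pose bv X : 'cV[R]_#|B| := \col_b box_monomial X (enum_val b : B).
have mZ X : X ord0 = 1 -> map_mx ratr Z *m mv X = \col_p g p X.
  move=> X0; apply/colP => q; rewrite !mxE -(Hh q).2 // Hz.
  by rewrite [RHS]sum_enum_val; apply: eq_bigr => a _; rewrite !mxE.
pose ev (u : R) : {rmorphism {poly rat} -> R} := horner_eval u \o map_poly ratr.
have evC u m n (M : 'M[rat]_(m, n)) : map_mx (ev u) (map_mx polyC M) = map_mx ratr M.
  by apply/matrixP => i k; rewrite !mxE /= map_polyC /= /horner_eval hornerC.
have evA u : map_mx (ev u) A = u%:M + map_mx ratr E.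
  rewrite /A /char_poly_mx map_mxB evC map_scalar_mx.
  by rewrite /= map_polyX /horner_eval hornerX map_mxN opprK.
have rel j : (t j)%:M *m mv (x j) + map_mx ratr E *m mv (x j)
    = t j *: (map_mx ratr C *m bv (x j)).
  apply/colP => a; rewrite mul_scalar_mx !mxE.
  have -> := Hce (enum_val a) (x j) (t j) (x0 j) (x_eq j).
  have -> : \sum_i map_mx ratr E a i * mv (x j) i 0
      = \sum_w ratr ((ce (enum_val a)).2 w) * monomial (x j) w.
    by rewrite [RHS]sum_enum_val; apply: eq_bigr => i _; rewrite !mxE.
  rewrite subrK [in LHS]sum_enum_val; congr (_ * _).
  by apply: eq_bigr => i _; rewrite !mxE.
have key j : ev (t j) (\det A) != 0 ->
   \sum_p ev (t j) (c 0 p) * g p (x j) = 0.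
  move=> dA0.
  have adjE : map_mx (ev (t j)) (\adj A) *m map_mx (ev (t j)) A = (ev (t j) (\det A))%:M.
    by rewrite -map_mxM mul_adj_mx map_scalar_mx.
  have H : ev (t j) (\det A) *: (map_mx ratr Z *m mv (x j)) =
    t j *: (map_mx ratr Z *m
      (map_mx (ev (t j)) (\adj A) *m (map_mx ratr C *m bv (x j)))).
    rewrite [in LHS]scalemxAr [in RHS]scalemxAr [in RHS]scalemxAr -rel -mulmxDl -evA.
    by rewrite (mulmxA _ _ (mv _)) adjE mul_scalar_mx.
  have := congr1 (mulmx (map_mx (ev (t j)) c)) H.
  have -> : map_mx (ev (t j)) c *m (t j *: (map_mx ratr Z *m
      (map_mx (ev (t j)) (\adj A) *m (map_mx ratr C *m bv (x j))))) = 0.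
    rewrite -scalemxAr -(evC (t j)) -(evC (t j) _ _ C) !mulmxA -!map_mxM.
    by rewrite !mulmxA in cW; rewrite cW map_mx0 mul0mx scaler0.
  rewrite mZ ?x0 // -scalemxAr.
  move=> /(congr1 (fun M : 'M[R]_1 => M 0 0)) /eqP; rewrite !mxE mulf_eq0 (negPf dA0) /=.
  by move=> /eqP H0; rewrite -[RHS]H0; apply: eq_bigr => i _; rewrite !mxE.
have detA0 : map_poly ratr (\det A) != 0.
  by rewrite map_poly_eq0 -/(char_poly _) monic_neq0 // char_poly_monic.
have /near_horner_neq0 near0 := detA0.
have lim0 : (fun j => \sum_p ev (t j) (c 0 p) * g p (x j)) @ \oo --> 0.
  apply: cvg_near_cst; apply: filterS near0 => j; exact: key.
exists (\row_p (c 0 p).[0]).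
  by apply/rV0Pn; exists p; rewrite mxE.
apply: (@cvg_seq_unique _ _ _ 0 _ lim0).
have gcvg q : (fun j => g q (x j)) @ \oo --> g q xl.
  by have [l _ Hl] := Hg q; apply: cvg_ratform (Hg q).
apply: cvg_bigsum => i.
apply: cvgM => //. rewrite mxE -horner_map /= rmorph0.
exact: cvg_horner.
Qed.
End Limit.

(** * Strict concavity of the determinant *)

(** The eigenvalues d_i of [S] are real with sum 0. The bound on \sum d_i ^ 2 gives |d_i| <= 1, so
    the numbers 1 + d_i are nonnegative with mean 1, and by the inequality of arithmetic and
    geometric means their product is at most 1. Equality makes all d_i equal, hence zero. *)
Lemma det_add1_lt1 (R : rcfType) n (S : 'M[R]_n) :
  S^T = S -> \tr S = 0 -> \tr (S *m S) <= 1 -> S != 0 -> \det (1%:M + S) < 1.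
Proof.
move=> Ssym Str Ssq S0; case: n => [|n] in S Ssym Str Ssq S0 *.
  by case/eqP: S0; apply/matrixP => -[].
pose toC : {rmorphism R -> R[i]} := real_complex R.
pose A : 'M[R[i]]_n.+1 := map_mx toC S.
have Areal : A \is a realmx.
  by apply/mxOverP => i j; rewrite mxE; apply/complex_realP; exists (S i j).
have Asym : A \is symmetricmx.
  apply/is_hermitianmxP; rewrite expr0 scale1r.
  by apply/matrixP => i j; rewrite !mxE -{1}Ssym mxE.
have Aherm := realsym_hermsym Asym Areal.
have /orthomx_spectralP AE := hermitian_normalmx Aherm.
set P := spectralmx A in AE; set D := spectral_diag A in AE.
have Pu : P \in unitmx by exact: spectral_unit.
have Dreal i : D 0 i \is Num.real.
  by have /mxOverP := hermitian_spectral_diag_real Aherm; apply.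
have conjE (M : 'M[R[i]]_n.+1) : \det (invmx P *m M *m P) = \det M /\
    \tr (invmx P *m M *m P) = \tr M.
  split; last by rewrite mxtrace_mulC mulmxA mulmxV // mul1mx.
  rewrite !det_mulmx mulrAC -det_mulmx mulVmx // det1 mul1r //.
have detE : \det (1%:M + A) = \prod_i (1 + D 0 i).
  rewrite [in LHS]AE -[1%:M](mulVmx Pu) -[X in X *m P + _]mulmx1 -mulmxDl -mulmxDr.
  rewrite (conjE _).1 -[1%:M]diag_const_mx -linearD det_diag.
  by apply: eq_bigr => i _; rewrite !mxE.
have trE : \sum_i D 0 i = 0.
  by rewrite -mxtrace_diag -(conjE (diag_mx D)).2 -AE /A trace_map_mx Str rmorph0.
have sqE : \sum_i D 0 i ^+ 2 <= 1.
  have -> : \sum_i D 0 i ^+ 2 = toC (\tr (S *m S)).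
    rewrite -trace_map_mx map_mxM -/A.
    have -> : A *m A = invmx P *m (diag_mx D *m diag_mx D) *m P.
      by rewrite {1 2}AE !mulmxA mulmxK.
    rewrite (conjE _).2 mul_diag_mx; apply: eq_bigr => i _.
    by rewrite !mxE eqxx mulr1n expr2.
  by rewrite -(rmorph1 toC) lecR.
have D_ge i : 0 <= 1 + D 0 i.
  have : D 0 i ^+ 2 <= 1.
    rewrite (le_trans _ sqE) // (bigD1 i) //= lerDl sumr_ge0 // => k _.
    by rewrite real_exprn_even_ge0.
  rewrite -real_normK // expr_le1 // real_ler_norml // => /andP[+ _].
  by rewrite -subr_ge0 opprK addrC.
have := leif_AGM (A := xpredT) (fun i _ => D_ge i).
rewrite big_split /= trE addr0 sumr_const card_ord divff ?pnatr_eq0 // expr1n.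
rewrite -detE => -[le1 eq1].
have {le1} : \det (1%:M + S) <= 1.
  by rewrite -lecR rmorph1 -[X in X <= _]/(toC _) -det_map_mx map_mxD map_mx1.
rewrite le_eqVlt => /predU1P[det1E|//]; case/eqP: S0.
have : \det (1%:M + A) == 1.
  by rewrite -(map_mx1 toC) -map_mxD det_map_mx det1E rmorph1.
rewrite eq1 => /forall_inP Dcst.
have Deq i : D 0 i = 0.
  have : \sum_(j < n.+1) D 0 i = 0.
    rewrite -[RHS]trE; apply: eq_bigr => j _.
    by have /forall_inP/(_ j isT)/eqP/addrI := Dcst i isT.
  by rewrite sumr_const card_ord => /eqP; rewrite mulrn_eq0 /= => /eqP.
have A0 : A = 0.
  by rewrite AE (_ : D = 0) ?linear0 ?mulmx0 ?mul0mx //; apply/rowP => i; rewrite Deq mxE.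
apply/matrixP => i j; apply: (fmorph_inj toC).
by have /matrixP/(_ i j) := A0; rewrite !mxE rmorph0.
Qed.

(** By compactness [phi] stays below [phi c - eta] on the boundary of a small ball. For small [t]
    the perturbation cannot make up for [eta], so the maximum over the closed ball is attained
    inside and is a local maximum. *)
Lemma perturbed_strict_max (R : realType) s (phi psi : 'rV[R]_s -> R)
    (c : 'rV[R]_s) (rho : R) :
  continuous phi -> continuous psi -> 0 < rho ->
  (forall x, x != c -> `|x - c| <= rho -> phi x < phi c) ->
  forall del, 0 < del -> exists t x, [/\ 0 < t < del, `|x - c| < del &
    exists2 e, 0 < e & forall y, `|y - x| < e ->
      phi y + t * psi y <= phi x + t * psi x].
Proof.
move=> phiC psiC rho0 strict del0 del_gt0.
pose del := Num.min del0 rho.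
have del_ge : 0 < del by rewrite lt_min del_gt0.
have ncont : continuous (fun x : 'rV[R]_s => `|x - c|).
  by move=> x; exact: cvg_norm (cvgB cvg_id (cvg_cst _)).
pose B := [set x : 'rV[R]_s | `|x - c| <= del].
have Bcl : closed B.
  apply: (@closed_comp _ _ (fun x : 'rV[R]_s => `|x - c|) [set y | y <= del]).
    by move=> x _; exact: ncont.
  exact: closed_le.
have Bb : bounded_set B.
  exists (`|c| + del); split; first by rewrite num_real.
  move=> M cM x Bx; apply: le_trans (ltW cM); rewrite -[x](subrK c) addrC.
  by apply: le_trans (ler_normD _ _) _; rewrite lerD2l.
have Bcp : compact B by exact: bounded_closed_compact.
have Bc : B c by rewrite /B /= subrr normr0 ltW.
have within_cont (A : set 'rV[R]_s) (f : 'rV[R]_s -> R) : continuous f -> {within A, continuous f}.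
  by move=> fC; exact: continuous_subspaceT.
have [c1 _ c1max] : exists2 c1, c1 \in B & forall x, x \in B -> `|psi x| <= `|psi c1|.
  apply: (@EVT_max_rV R _ (fun x => `|psi x|)) => //; first by exists c.
  by apply: within_cont => x; exact: cvg_norm (psiC x).
pose S := [set x : 'rV[R]_s | `|x - c| = del].
have [eta eta0 etaP] : exists2 eta, 0 < eta & forall x, S x -> phi x <= phi c - eta.
  have [[x0 Sx0]|S0] := pselect (S !=set0); last first.
    by exists 1 => // x Sx; case: S0; exists x.
  have Scp : compact S.
    have -> : S = B `&` [set x | del <= `|x - c|].
      apply/seteqP; split => x /=; rewrite /S /B /=; first by move=> ->.
      by move=> [le1 le2]; apply/eqP; rewrite eq_le le1.
    apply: compact_closedI => //.
    apply: (@closed_comp _ _ (fun x : 'rV[R]_s => `|x - c|) [set y | del <= y]).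
      by move=> x _; exact: ncont.
    exact: closed_ge.
  have [c2 /set_mem Sc2 c2max] : exists2 c2, c2 \in S & forall x, x \in S -> phi x <= phi c2.
    by apply: EVT_max_rV => //; [exists x0|exact: within_cont].
  exists (phi c - phi c2); last by move=> x Sx; rewrite subKr; apply: c2max; exact: mem_set.
  rewrite subr_gt0; apply: strict; last by rewrite Sc2 ge_min lexx orbT.
  by apply: contra_eq_neq Sc2 => ->; rewrite subrr normr0 lt_eqF.
pose C := `|psi c1|.
have C0 : 0 <= C by exact: normr_ge0.
(* [C] bounds [psi] in absolute value on the ball, so [t * psi] varies by at most 2 t C < eta there;
   [C + 1] keeps the denominator positive. *)
pose t := Num.min (del0 / 2) (eta / (4 * (C + 1))).
have t0 : 0 < t by rewrite lt_min !divr_gt0 // mulr_gt0 // ltr_wpDl.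
have tC : 2 * (t * C) < eta.
  have : t <= eta / (4 * (C + 1)) by rewrite ge_min lexx orbT.
  rewrite ler_pdivlMr ?mulr_gt0 ?ltr_wpDl // => h.
  by nra.
have [x /set_mem Bx xmax] : exists2 x, x \in B &
    forall y, y \in B -> phi y + t * psi y <= phi x + t * psi x.
  apply: (@EVT_max_rV R _ (fun x => phi x + t * psi x)) => //; first by exists c.
  by apply: within_cont => x; exact: cvgD (phiC x) (cvgM (cvg_cst _) (psiC x)).
exists t, x; have psiB y : B y -> - C <= psi y <= C.
  by move=> By; rewrite -ler_norml; apply: c1max; exact: mem_set.
have xlt : `|x - c| < del.
  rewrite lt_neqAle Bx andbT; apply/eqP => Sx.
  have := etaP _ Sx; have := xmax _ (mem_set Bc).
  have /andP[_ h1] := psiB _ Bx; have /andP[h2 _] := psiB _ Bc.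
  by nra.
split.
- by rewrite t0 /= /t gt_min; apply/orP; left; rewrite ltr_pdivrMr // ltr_pMr // ltr1n.
- by rewrite (lt_le_trans xlt) // ge_min lexx.
exists (del - `|x - c|); first by rewrite subr_gt0.
move=> y ye; apply: xmax; apply: mem_set; rewrite /B /=.
have -> : y - c = (y - x) + (x - c) by rewrite addrA subrK.
by rewrite (le_trans (ler_normD _ _)) // -lerBrDr ltW.
Qed.

Lemma deriv_prod (R : comNzRingType) (I : eqType) (r : seq I) (F : I -> {poly R}) :
  uniq r ->
  (\prod_(i <- r) F i)^`()
    = \sum_(i <- r) (F i)^`() * \prod_(j <- r | j != i) F j.
Proof.
elim: r => [|k r IH] /=; first by rewrite !big_nil derivC.
move=> /andP[kr ur]; rewrite !big_cons derivM IH // eqxx /=; congr (_ * _ + _).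
  rewrite big_seq [RHS]big_seq_cond; apply: eq_bigl => j.
  by case: (boolP (j \in r)) => //= jr; apply/esym; apply: contraNneq kr => <-.
rewrite big_distrr /= !big_seq; apply: eq_bigr => i ir.
rewrite big_cons ifT; last by apply: contraNneq kr => ->.
by rewrite mulrCA.
Qed.

(** The derivative of det at [M] in direction [N], that is [\tr (\adj M *m N)], in Leibniz form so
    that the degree [n.-1] in the entries of [M] is visible. *)
Definition det_deriv (R : comNzRingType) n (M N : 'M[R]_n) : R :=
  \sum_(p : 'S_n) (-1) ^+ p * \sum_a N a (p a) * \prod_(b | b != a) M b (p b).

Lemma horner0_deriv_det (R : comNzRingType) n (M N : 'M[R]_n) :
  (\det (map_mx polyC M + 'X *: map_mx polyC N))^`().[0] = det_deriv M N.
Proof.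
rewrite /determinant raddf_sum horner_sum; apply: eq_bigr => p _.
have -> : ((-1) ^+ p : {poly R}) = ((-1) ^+ p)%:P by rewrite rmorphXn rmorphN1.
rewrite /= mul_polyC derivZ hornerZ deriv_prod ?index_enum_uniq // horner_sum; congr (_ * _).
apply: eq_bigr => a _; rewrite !mxE derivD derivM derivX !derivC mul1r mulr0 addr0 add0r.
rewrite hornerM hornerC horner_prod.
by congr (_ * _); apply: eq_bigr => b _;
rewrite !mxE hornerD hornerM hornerX !hornerC mul0r addr0.
Qed.

(** * Critical points of the determinant on rational affine spaces of matrices *)

Section Pencil.
Variables (R : realType) (n s : nat) (E : 'I_s.+1 -> 'M[rat]_n).

Definition ratpencil (X : 'I_s.+1 -> R) : 'M[R]_n :=
  \sum_l X l *: map_mx ratr (E l).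

Lemma ratform_pencil a b : ratform 1 (fun X => ratpencil X a b).
Proof.
pose g l (X : 'I_s.+1 -> R) := ratr (E l a b) * X l.
apply: (@ratform_ext _ _ _ (fun X => \sum_l g l X)).
  by move=> X; rewrite summxE; apply: eq_bigr => l _; rewrite !mxE mulrC.
by apply: ratform_sum => l; apply: ratformZ; exact: ratform_var.
Qed.

Lemma ratform_det_deriv i :
  ratform n.-1 (fun X => det_deriv (ratpencil X) (map_mx ratr (E i))).
Proof.
apply: ratform_sum => p.
have sgnE : ((-1) ^+ p : R) = ratr ((-1) ^+ p) by rewrite rmorphXn rmorphN1.
rewrite sgnE; apply: ratformZ; apply: ratform_sum => a.
rewrite mxE; apply: ratformZ.
have sz : size [seq b <- index_enum 'I_n | b != a] = n.-1.
  by rewrite size_filter -sum1_count sum1_card (cardC1 a) card_ord.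
apply: (@ratform_ext _ _ _ (fun X =>
    \prod_(b <- [seq b <- index_enum 'I_n | b != a]) ratpencil X b (p b))).
  by move=> X; rewrite big_filter.
by rewrite -sz; apply: ratform_prod => b; exact: ratform_pencil.
Qed.
End Pencil.

Lemma horner_max_deriv0 (R : realType) (p : {poly R}) e : 0 < e ->
  (forall u, `|u| < e -> p.[u] <= p.[0]) -> p^`().[0] = 0.
Proof.
move=> e0 pmax.
have H : is_derive (0:R) (1:R) (horner p) 0.
  apply: (@derive1_at_max R (horner p) (- e) e 0).
  - by rewrite (le_trans (y := 0)) ?oppr_le0 // ltW.
  - by move=> u _; have := is_derive_poly p u; case.
  - by rewrite in_itv /= oppr_lt0 e0.
  - by move=> u; rewrite in_itv /= -ltr_norml => /pmax.
have H2 := is_derive_poly p 0.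
by rewrite -(@derive_val _ _ _ _ _ _ _ H2) (@derive_val _ _ _ _ _ _ _ H).
Qed.

Section CriticalPoint.
Variables (R : realType) (n s : nat) (E : 'I_s.+1 -> 'M[rat]_n) (A : 'M[R]_n)
  (xl : 'I_s.+1 -> R).
Local Notation ratrM := (map_mx (ratr : rat -> R)).
Local Notation pencil := (ratpencil E).
Hypothesis n_gt0 : (0 < n)%N.
Hypothesis xl0 : xl ord0 = 1.
Hypothesis E_sym : forall l, (E l)^T = E l.
Hypothesis A_unit : A \in unitmx.
Hypothesis xlE : pencil xl = A *m A^T.
Hypothesis crit : forall i,
  \tr (invmx A *m ratrM (E (lift ord0 i)) *m (invmx A)^T) = 0.
Hypothesis indep : forall y : 'I_s -> R,
  \sum_i y i *: ratrM (E (lift ord0 i)) = 0 -> forall i, y i = 0.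

Let coords (x : 'rV[R]_s) (l : 'I_s.+1) : R :=
  if unlift ord0 l is Some i then x 0 i else 1.
Let c : 'rV[R]_s := \row_i xl (lift ord0 i).

Let coords0 x : coords x ord0 = 1.
Proof. by rewrite /coords unlift_none. Qed.

Let coordsS x i : coords x (lift ord0 i) = x 0 i.
Proof. by rewrite /coords liftK. Qed.

Let coords_c : coords c = xl.
Proof.
apply/funext => l; case: (unliftP ord0 l) => [i|] ->; first by rewrite coordsS mxE.
by rewrite coords0.
Qed.

Let pencilE x :
  pencil (coords x) = ratrM (E ord0) + \sum_i x 0 i *: ratrM (E (lift ord0 i)).
Proof.
rewrite /ratpencil big_ord_recl coords0 scale1r; congr (_ + _).
by apply: eq_bigr => i _; rewrite coordsS.
Qed.

(** The increment from [c] to [x] seen in the frame [A]: the pencil at [x] is [1 + S x] up to the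
    congruence by [A]. Then [crit] says that [S x] has trace 0, and [indep] that it vanishes only at
    [c]. *)
Let S x : 'M[R]_n := invmx A *m (\sum_i (x - c) 0 i *: ratrM (E (lift ord0 i)))
  *m (invmx A)^T.

Let pencilS x : pencil (coords x) = A *m (1%:M + S x) *m A^T.
Proof.
rewrite mulmxDr mulmxDl mulmx1 -xlE /S !mulmxA mulmxV // mul1mx -mulmxA -trmx_mul.
rewrite mulmxV // trmx1 mulmx1 -coords_c !pencilE -addrA; congr (_ + _).
rewrite -big_split; apply: eq_bigr => i _ /=.
by rewrite -scalerDl; congr (_ *: _); rewrite !mxE addrCA subrr addr0.
Qed.

Let coords_continuous l : continuous (fun x : 'rV[R]_s => coords x l).
Proof.
case: (unliftP ord0 l) => [i|] ->; last first.
  by under eq_fun do rewrite coords0; exact: cst_continuous.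
by under eq_fun do rewrite coordsS; exact: coord_continuous.
Qed.

Let phi x := \det (pencil (coords x)).
Let psi (x : 'rV[R]_s) := \sum_i n%:R^-1 * x 0 i ^+ n.

Let phi_continuous : continuous phi.
Proof.
apply: continuous_bigsum => p; apply: continuous_mul; first exact: cst_continuous.
apply: continuous_bigprod => a; rewrite /ratpencil; under eq_fun do rewrite summxE.
apply: continuous_bigsum => l; under eq_fun do rewrite mxE.
by apply: continuous_mul; [exact: coords_continuous|exact: cst_continuous].
Qed.

Let psi_continuous : continuous psi.
Proof.
apply: continuous_bigsum => i; apply: continuous_mul; first exact: cst_continuous.
move=> x; apply: (@continuous_comp _ _ _ (fun x : 'rV[R]_s => x 0 i) (fun y => y ^+ n)).
  exact: coord_continuous.
exact: exprn_continuous.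
Qed.

Let S_sym x : (S x)^T = S x.
Proof.
rewrite /S !trmx_mul trmxK -mulmxA linear_sum /=; congr (_ *m (_ *m _)).
by apply: eq_bigr => i _; rewrite linearZ /= map_trmx E_sym.
Qed.

Let S_tr x : \tr (S x) = 0.
Proof.
rewrite /S mulmx_sumr mulmx_suml raddf_sum big1 //= => i _.
by rewrite -scalemxAr -scalemxAl linearZ /= crit mulr0.
Qed.

Let S_neq0 x : x != c -> S x != 0.
Proof.
apply: contra_neq => S0; apply/eqP; rewrite -subr_eq0; apply/eqP/rowP => i.
rewrite [RHS]mxE; apply: (indep (y := fun i => (x - c) 0 i)).
have : A *m S x *m A^T = 0 by rewrite S0 mulmx0 mul0mx.
rewrite /S !mulmxA mulmxV // mul1mx -mulmxA -trmx_mul mulmxV // trmx1 mulmx1.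
by [].
Qed.

(** [S] is continuous and zero at [c], so \tr (S x S x) < 1 near [c], which is the range in which
    [det_add1_lt1] applies. *)
Let strict : exists2 rho, 0 < rho &
  forall x, x != c -> `|x - c| <= rho -> phi x < phi c.
Proof.
have Scont a b : continuous (fun x => S x a b).
  have SE : (fun x => S x a b) = fun x => \sum_i (x 0 i - c 0 i) *
      (invmx A *m ratrM (E (lift ord0 i)) *m (invmx A)^T) a b.
    apply/funext => x; rewrite /S mulmx_sumr mulmx_suml summxE.
    apply: eq_bigr => i _; rewrite -scalemxAr -scalemxAl mxE; congr (_ * _).
    by rewrite mxE [in X in _ + X]mxE.
  rewrite SE; apply: continuous_bigsum => i.
  apply: continuous_mul; last exact: cst_continuous.
  by move=> x; exact: cvgB (@coord_continuous _ _ _ 0 i x) (cvg_cst _).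
have trcont : continuous (fun x => \tr (S x *m S x)).
  apply: continuous_bigsum => a; under eq_fun do rewrite mxE.
  by apply: continuous_bigsum => b; exact: continuous_mul.
have Sc : S c = 0.
  rewrite /S big1 ?mulmx0 ?mul0mx // => i _; by rewrite subrr mxE scale0r.
have : \forall x \near c, \tr (S x *m S x) < 1.
  apply: (cvgr_lt _ (trcont c)); by rewrite Sc mulmx0 linear0.
move=> /nbhs_ballP[e /= e0 He]; exists (e / 2); first by rewrite divr_gt0.
move=> x xc xe; rewrite /phi !pencilS !det_mulmx Sc addr0 det1 mulr1.
have A0 : 0 < \det A * \det A^T.
  by rewrite det_tr -expr2 lt_neqAle sqr_ge0 eq_sym sqrf_eq0 -unitfE -unitmxE A_unit.
rewrite mulrAC -[ltRHS]mulr1 ltr_pM2l //; apply: det_add1_lt1 => //.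
  apply/ltW/He; rewrite -ball_normE /= distrC (le_lt_trans xe) //.
  by rewrite ltr_pdivrMr // ltr_pMr // ltr1n.
exact: S_neq0 xc.
Qed.

Let f i X := det_deriv (pencil X) (ratrM (E (lift ord0 i))).

Let approx (j : nat) : exists tx : R * 'rV[R]_s, [/\ 0 < tx.1 < j.+1%:R^-1,
  `|tx.2 - c| < j.+1%:R^-1 &
  forall i, tx.1 * coords tx.2 (lift ord0 i) ^+ n.-1 = - f i (coords tx.2)].
Proof.
have [rho rho0 smax] := strict.
have del0 : (0 : R) < j.+1%:R^-1 by rewrite invr_gt0.
have [t [x [tj xj [e e0 loc]]]] :=
  perturbed_strict_max phi_continuous psi_continuous rho0 smax del0.
exists (t, x); split=> //= i.
(* The perturbed function along the [i]-th coordinate line through its local maximum [x], as a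
   polynomial in the parameter; the last term collects the part of [psi] that is constant on the
   line. *)
pose p : {poly R} := \det (map_mx polyC (pencil (coords x)) +
    'X *: map_mx polyC (ratrM (E (lift ord0 i))))
  + (t / n%:R)%:P * ((x 0 i)%:P + 'X) ^+ n
  + (t * \sum_(k | k != i) n%:R^-1 * x 0 k ^+ n)%:P.
have pE u : p.[u] = phi (x + u *: delta_mx 0 i) + t * psi (x + u *: delta_mx 0 i).
  pose y := x + u *: delta_mx 0 i.
  have yE k : y 0 k = if k == i then x 0 i + u else x 0 k.
    by rewrite !mxE /= eq_sym; case: eqP => [->|_]; rewrite ?mulr1 ?mulr0 ?addr0.
  have pencily : pencil (coords y)
      = pencil (coords x) + u *: ratrM (E (lift ord0 i)).
    rewrite !pencilE -addrA; congr (_ + _).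
    rewrite (bigD1 i) //= [in RHS](bigD1 i) //= yE eqxx scalerDl addrAC.
    congr (_ + _ + _); apply: eq_bigr => k /negPf ki; by rewrite yE ki.
  rewrite /p !hornerD !hornerM !hornerC -/y -addrA; congr (_ + _).
    rewrite -horner_evalE -det_map_mx /phi pencily; congr (\det _).
    by apply/matrixP => a b; rewrite !mxE /= /horner_eval hornerD hornerM hornerX !hornerC.
  rewrite horner_exp hornerD hornerC hornerX /psi [in RHS](bigD1 i) //= yE eqxx.
  rewrite mulrDr mulrA; congr (_ + _ * _).
  by apply: eq_bigr => k /negPf ki; rewrite yE ki.
have : p^`().[0] = 0.
  pose dl : 'rV[R]_s := delta_mx 0 i.
  have dl0 : 0 < `|dl| + 1 by rewrite ltr_wpDl.
  apply: (@horner_max_deriv0 _ _ (e / (`|dl| + 1))); first by rewrite divr_gt0.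
  move=> u ue; rewrite !pE scale0r addr0; apply: loc.
  rewrite addrC addKr normrZ; apply: le_lt_trans (_ : `|u| * (`|dl| + 1) < e).
    by rewrite ler_wpM2l // lerDl.
  by rewrite -ltr_pdivlMr.
rewrite /p !derivD derivC addr0 hornerD horner0_deriv_det -/(f i _).
rewrite derivM derivC mul0r add0r hornerM hornerC deriv_exp derivD derivC derivX add0r mul1r.
rewrite hornerMn horner_exp hornerD hornerC hornerX addr0 coordsS => /eqP.
rewrite addr_eq0 => /eqP ->; rewrite opprK.
by rewrite -[_ ^+ _ *+ n]mulr_natr mulrCA divfK 1?mulrC // pnatr_eq0 -lt0n.
Qed.

Theorem critical_point_dependent (g : 'I_(n.-1 ^ s).+1 -> ('I_s.+1 -> R) -> R) :
  (forall p, exists D, ratform D (g p)) -> rat_dependent (fun p => g p xl).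
Proof.
have /choice[tx Htx] := approx.
apply: (@limit_dependent R s n.-1 f _ (fun j => coords (tx j).2) (fun j => (tx j).1) xl).
- by move=> i; exact: ratform_det_deriv.
- by move=> j; exact: coords0.
- by move=> j; have [/andP[/lt0r_neq0]] := Htx j.
- apply: (squeeze_cvgr _ (cvg_cst 0) (@cvg_harmonic R)).
  by apply: nearW => j; have [/andP[/ltW-> /ltW->]] := Htx j.
- move=> l; rewrite -coords_c.
  have xc : (fun j => (tx j).2) @ \oo --> c.
    apply/cvgrPdist_lt => e e0; have /cvgrPdist_lt/(_ e e0) := @cvg_harmonic R.
    apply: filterS => j; rewrite sub0r normrN ger0_norm ?invr_ge0 //.
    by apply: lt_trans; rewrite distrC; have [] := Htx j.
  apply: (@cvg_comp _ _ _ (fun j => (tx j).2) (fun x => coords x l) _ _ _ xc).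
  exact: coords_continuous.
- by move=> j i; have [] := Htx j.
Qed.

End CriticalPoint.

(** * The ring generated by the coordinates of the critical point is a field *)

Section FormField.
Variables (R : numFieldType) (s m : nat) (X : 'I_s.+1 -> R).
Hypothesis X0 : X ord0 = 1.
Hypothesis dep : forall g : 'I_m.+1 -> ('I_s.+1 -> R) -> R,
  (forall p, exists D, ratform D (g p)) -> rat_dependent (fun p => g p X).

Definition form_values : {pred R} :=
  fun y => `[< exists D, exists2 g, ratform D g & g X = y >].

Lemma form_valuesP y :
  reflect (exists D, exists2 g, ratform D g & g X = y) (y \in form_values).
Proof. exact: asboolP. Qed.

Lemma form_valuesD y z :
  y \in form_values -> z \in form_values -> y + z \in form_values.
Proof.
move=> /form_valuesP[D [g gD <-]] /form_valuesP[D' [h hD' <-]].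
have [g' g'D gE] := ratform_raise D' gD; have [h' h'D hE] := ratform_raise D hD'.
apply/form_valuesP; exists (D + D')%N, (fun X => g' X + h' X); last by rewrite gE // hE.
by apply: ratformD => //; rewrite addnC.
Qed.

Lemma form_valuesM y z :
  y \in form_values -> z \in form_values -> y * z \in form_values.
Proof.
move=> /form_valuesP[D [g gD <-]] /form_valuesP[D' [h hD' <-]].
by apply/form_valuesP; exists (D + D')%N, (fun X => g X * h X) => //; exact: ratformM.
Qed.

Lemma form_values_rat a : ratr a \in form_values.
Proof. by apply/form_valuesP; exists 0, (fun=> ratr a) => //; exact: ratform_cst. Qed.

Lemma form_values_horner (p : {poly rat}) y :
  y \in form_values -> (map_poly ratr p).[y] \in form_values.
Proof.
move=> yS; elim/poly_ind: p => [|p c IH].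
  by rewrite rmorph0 horner0 -(rmorph0 (ratr : {rmorphism rat -> R}))
    form_values_rat.
rewrite rmorphD rmorphM /= map_polyX map_polyC /= hornerMXaddC.
by apply: form_valuesD; [exact: form_valuesM|exact: form_values_rat].
Qed.

Lemma form_values_dependent (y : 'I_m.+1 -> R) :
  (forall p, y p \in form_values) -> rat_dependent y.
Proof.
move=> yS; have /choice[g Hg] p : exists g, (exists D, ratform D g) /\ g X = y p.
  by have /form_valuesP[D [g gD gy]] := yS p; exists g; split=> //; exists D.
have [c c0 Hc] := dep (fun p => (Hg p).1); exists c => //.
by rewrite -[RHS]Hc; apply: eq_bigr => p _; rewrite (Hg p).2.
Qed.

(** The powers of [y] are dependent, so [y] is a root of a rational polynomial. As [y] is nonzero,
    powers of ['X] can be divided out until the constant term is nonzero, and then [y^-1] is a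
    polynomial in [y]. *)
Lemma form_valuesV y : y \in form_values -> y^-1 \in form_values.
Proof.
move=> yS; have [->|y0] := eqVneq y 0; first by rewrite invr0 -(rmorph0 (ratr : {rmorphism rat -> R}))
  form_values_rat.
have [p [p0 _ py]] : exists p : {poly rat},
    [/\ p != 0, (size p <= m.+1)%N & root (map_poly ratr p) y].
  apply: rat_dependent_powers; apply: form_values_dependent => i.
  by have := form_values_horner 'X^i yS; rewrite map_polyXn hornerXn.
have [k [q + pE]] := multiplicity_XsubC p 0; rewrite p0 /= => q0.
have qy : root (map_poly ratr q) y.
  move: py; rewrite pE subr0 rmorphM rmorphXn /= map_polyX rootM => /orP[//|].
  by rewrite rootE hornerXn expf_eq0 (negPf y0) andbF.
have /factor_theorem[r rE] : root (q - (q.[0])%:P) 0 by rewrite rootE hornerD hornerN hornerC subrr.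
have : y * (map_poly ratr r).[y] = - ratr q.[0].
  have : q = r * 'X + (q.[0])%:P by rewrite -[in LHS](subrK (q.[0])%:P q) rE subr0.
  move=> /(congr1 (fun q : {poly rat} => (map_poly (ratr : rat -> R) q).[y])).
  rewrite (rootP qy) rmorphD rmorphM /= map_polyX map_polyC /= hornerMXaddC.
  by move=> /esym/eqP; rewrite addr_eq0 mulrC => /eqP.
move=> yr; have -> : y^-1 = ratr (- (q.[0])^-1) * (map_poly ratr r).[y].
  apply: (mulfI y0); rewrite divff // mulrCA yr rmorphN fmorphV mulrNN mulVf //.
  by rewrite fmorph_eq0.
by apply: form_valuesM; [exact: form_values_rat|exact: form_values_horner].
Qed.

Lemma form_values_divring : divring_closed form_values.
Proof.
split; first by rewrite -(rmorph1 (ratr : {rmorphism rat -> R})) form_values_rat.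
  move=> y z yS zS; apply: form_valuesD => //.
  rewrite -mulN1r -(rmorph1 (ratr : {rmorphism rat -> R})) -rmorphN.
  by apply: form_valuesM => //; exact: form_values_rat.
by move=> y z yS zS; apply: form_valuesM => //; exact: form_valuesV.
Qed.

End FormField.

(** * Gram matrices *)

Lemma mxvec_dot (F : comNzRingType) m n (M N : 'M[F]_(m, n)) :
  (mxvec M *m (mxvec N)^T) 0 0 = \tr (M *m N^T).
Proof.
rewrite mxE (reindex _ (curry_mxvec_bij _ _)) /=.
rewrite /mxtrace; under [RHS]eq_bigr do rewrite mxE.
rewrite pair_bigA /=; apply: eq_bigr => -[i j] _ /=.
by rewrite mxE !mxvecE mxE.
Qed.

Lemma tr_quad (F : comNzRingType) n (M : 'M[F]_n) (k : 'rV[F]_n) :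
  \tr (M *m (k^T *m k)) = (k *m M *m k^T) 0 0.
Proof. by rewrite mulmxA mxtrace_mulC mulmxA [LHS]/mxtrace big_ord1. Qed.

(** A basis of the span of an arbitrary set of vectors, taken from the set itself: every row of [U]
    must come from a frequency, so that [P] takes the value 1 on it. *)
Lemma maximal_row_free (F : fieldType) N (Y : 'rV[F]_N -> Prop) :
  exists r (U : 'M[F]_(r, N)), [/\ row_free U, forall i, Y (row i U) &
    forall v, Y v -> (v <= U)%MS].
Proof.
pose P r := `[< exists U : 'M[F]_(r, N), row_free U /\ forall i, Y (row i U) >].
have P0 : exists r, P r.
  by exists 0%N; apply/asboolP; exists 0; split=> [|[]//]; rewrite /row_free mxrank0.
have Pub r : P r -> (r <= N)%N.
  by move=> /asboolP[U [/eqP rU _]]; rewrite -[leqLHS]rU rank_leq_col.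
case: (ex_maxnP P0 Pub) => r /asboolP[U [Ufree UY]] rmax; exists r, U; split=> // v Yv.
apply: contraT => vU; suff /rmax : P (r + 1)%N by rewrite addn1 ltnn.
apply/asboolP; exists (col_mx U v); split; last first.
  move=> i; case: (split_ordP i) => j ->; first by rewrite rowKu.
  by rewrite rowKd [j]ord1 (_ : row 0 v = v) //; apply/rowP => l; rewrite mxE.
suff : (\rank U < \rank (col_mx U v))%N.
  by rewrite (eqP Ufree) /row_free eqn_leq rank_leq_row /=; apply: leq_trans; rewrite addn1.
by rewrite -addsmxE rank_ltmx // ltmxE addsmxSl /= addsmx_sub submx_refl.
Qed.

Section SymmetricRank.
Variables (F : fieldType) (n : nat).

Definition transpose_mx : 'M[F]_(n * n) := lin_mx (@trmx F n n).

Lemma mul_transpose_mx (M : 'M[F]_n) : mxvec M *m transpose_mx = mxvec M^T.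
Proof. by rewrite mul_vec_lin. Qed.

(** The entries on and above the diagonal determine a symmetric matrix, so the map [Sel] that reads
    them off is injective on the row space of [W]. *)
Lemma symmetric_rank r (W : 'M[F]_(r, n * n)) :
  W *m (1%:M - transpose_mx) = 0 -> (\rank W <= (n * n.+1)./2)%N.
Proof.
move=> Wsym; pose T : finType := {p : 'I_n * 'I_n | (p.1 <= p.2)%N}.
have cardT : #|T| = (n * n.+1)./2.
  rewrite card_sig -sum1_card big_mkcond /=.
  rewrite -(pair_bigA _ (fun i j : 'I_n => if (i <= j)%N then 1%N else 0%N)).
  rewrite exchange_big /=; transitivity (\sum_(j < n) j.+1)%N.
    apply: eq_bigr => j _; rewrite -big_mkcond /=.
    by rewrite -[RHS]card_ord -sum1_card (big_ord_widen n (fun=> 1%N) (ltn_ord j)).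
  by elim: (n) => [|k IH]; rewrite ?big_ord0 // big_ord_recr /= IH; lia.
pose Sel : 'M[F]_(n * n, #|T|) := \matrix_(i, p)
  (i == mxvec_index (val (enum_val p)).1 (val (enum_val p)).2)%:R.
have SelE (M : 'M[F]_n) p :
    (mxvec M *m Sel) 0 p = M (val (enum_val p)).1 (val (enum_val p)).2.
  rewrite mxE (bigD1 (mxvec_index (val (enum_val p)).1 (val (enum_val p)).2)) //=.
  rewrite mxvecE mxE eqxx mulr1 big1 ?addr0 // => i /negPf ine.
  by rewrite mxE ine mulr0.
rewrite -cardT; have := mxrank_mul_ker W Sel.
suff -> : (W :&: kermx Sel)%MS = 0.
  by rewrite mxrank0 addn0 => <-; exact: rank_leq_col.
apply/eqP/rowV0P => v; rewrite sub_capmx => /andP[/submxP[x vx] /sub_kermxP vS].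
have [M ME] : exists M : 'M[F]_n, v = mxvec M by exists (vec_mx v); rewrite vec_mxK.
have Msym : M^T = M.
  apply: (can_inj mxvecK); rewrite -mul_transpose_mx -ME.
  have : v *m (1%:M - transpose_mx) = 0 by rewrite vx -mulmxA Wsym mulmx0.
  by rewrite mulmxBr mulmx1 => /eqP; rewrite subr_eq0 => /eqP.
rewrite ME; apply/eqP; rewrite mxvec_eq0; apply/eqP/matrixP => i j; rewrite [RHS]mxE.
wlog ij : i j / (i <= j)%N.
  by move=> H; case/orP: (leq_total i j) => /H // <-; rewrite -{1}Msym mxE.
pose p : T := exist _ (i, j) ij.
have /rowP/(_ (enum_rank p)) := vS.
by rewrite ME SelE enum_rankK mxE.
Qed.

End SymmetricRank.

Lemma critical_point_field (R : realType) n s (E : 'I_s.+1 -> 'M[rat]_n)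
    (A : 'M[R]_n) (xl : 'I_s.+1 -> R) :
  (0 < n)%N -> xl ord0 = 1 -> (forall l, (E l)^T = E l) -> A \in unitmx ->
  ratpencil E xl = A *m A^T ->
  (forall i, \tr (map_mx ratr (E (lift ord0 i)) *m (invmx A)^T *m invmx A) = 0) ->
  (forall y : 'I_s -> R,
    \sum_i y i *: map_mx ratr (E (lift ord0 i)) = 0 -> forall i, y i = 0) ->
  exists S : {pred R}, [/\ divring_closed S, forall a b, (A *m A^T) a b \in S &
    forall y : 'I_(n.-1 ^ s).+1 -> R, (forall i, y i \in S) -> rat_dependent y].
Proof.
move=> n0 x0 Esym Au xlE crit indep.
have crit' i : \tr (invmx A *m map_mx ratr (E (lift ord0 i)) *m (invmx A)^T) = 0.
  by rewrite -mulmxA mxtrace_mulC crit.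
have dep := @critical_point_dependent R n s E A xl n0 x0 Esym Au xlE crit' indep.
exists (form_values xl); split.
- exact: form_values_divring dep.
- move=> a b; apply/form_valuesP; exists 1%N, (fun X => ratpencil E X a b).
    exact: ratform_pencil.
  by rewrite xlE.
- exact: form_values_dependent.
Qed.

(** By the adjugate formula. In the dual case the field obtained contains the entries of [P], and
    this brings back those of [Q]. *)
Lemma divring_closed_invmx (R : fieldType) (S : {pred R}) n (M : 'M[R]_n) :
  divring_closed S -> (forall i j, M i j \in S) -> forall i j, invmx M i j \in S.
Proof.
move=> [S1 SB SV] MS i j; rewrite /invmx; case: ifP => // _.
have S0 : 0 \in S by rewrite -(subrr 1) SB.
have SN x : x \in S -> - x \in S by move=> xS; rewrite -sub0r SB.
have SD x y : x \in S -> y \in S -> x + y \in S.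
  by move=> xS yS; rewrite -[y]opprK SB ?SN.
have SI x : x \in S -> x^-1 \in S by move=> xS; rewrite -div1r SV.
have SM x y : x \in S -> y \in S -> x * y \in S.
  by move=> xS yS; rewrite -[y]invrK SV ?SI.
have Ssum I (r : seq I) (F : I -> R) : (forall i, F i \in S) -> \sum_(i <- r) F i \in S.
  by move=> FS; elim: r => [|k r IH]; rewrite ?big_nil ?big_cons ?SD.
have Sprod I (r : seq I) (F : I -> R) : (forall i, F i \in S) -> \prod_(i <- r) F i \in S.
  by move=> FS; elim: r => [|k r IH]; rewrite ?big_nil ?big_cons ?SM.
have Ssign k : (-1) ^+ k \in S by elim: k => [|k IH]; rewrite ?expr0 ?exprS ?SM ?SN.
have Sdet m (N : 'M[R]_m) : (forall i j, N i j \in S) -> \det N \in S.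
  by move=> NS; apply: Ssum => p; apply: SM => //; apply: Sprod.
rewrite !mxE /cofactor SM ?SI ?SM ?Sdet // => a b; by rewrite !mxE.
Qed.

(** * The two dual critical point problems for the Gram matrix *)

Section GramField.
Variables (R : realType) (n : nat) (Q A : 'M[R]_n) (Y : 'rV[rat]_n -> Prop).
Local Notation ratrM := (map_mx (ratr : rat -> R)).
Let veronese (k : 'rV[rat]_n) : 'rV_(n * n) := mxvec (k^T *m k).
Hypothesis n_gt0 : (0 < n)%N.
Hypothesis A_unit : A \in unitmx.
Hypothesis QE : Q = A *m A^T.
Hypothesis Y_unit : forall k, Y k -> (ratrM k *m invmx Q *m (ratrM k)^T) 0 0 = 1.
Hypothesis Y_span : forall H : 'M[R]_n,
  (forall k, Y k -> (ratrM k *m H *m (ratrM k)^T) 0 0 = 0) -> \tr (H *m Q) = 0.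

Let Q_sym : Q^T = Q. Proof. by rewrite QE trmx_mul trmxK. Qed.

Let Q_unit : Q \in unitmx. Proof. by rewrite QE unitmx_mul unitmx_tr A_unit. Qed.

Let quad (M : 'M[R]_n) k :
  (ratrM k *m M *m (ratrM k)^T) 0 0 = (mxvec M *m (ratrM (veronese k))^T) 0 0.
Proof.
rewrite /veronese map_mxvec map_mxM -map_trmx mxvec_dot trmx_mul trmxK.
by rewrite tr_quad.
Qed.

Lemma map_transpose_mx : ratrM (@transpose_mx rat n) = @transpose_mx R n.
Proof. by apply: map_lin_mx => M; rewrite map_trmx. Qed.

Lemma row_dot_eq0 (F : realFieldType) N (u : 'rV[F]_N) : u *m u^T = 0 -> u = 0.
Proof.
move=> /matrixP/(_ 0 0); rewrite mxE [RHS]mxE => /eqP.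
rewrite psumr_eq0 => [/allP u0|i _]; last by rewrite mxE -expr2 sqr_ge0.
apply/rowP => i; have := u0 i (mem_index_enum _).
by rewrite !mxE -expr2 sqrf_eq0 => /eqP.
Qed.

Let mapvec (v : 'rV[rat]_(n * n)) : ratrM (vec_mx v) = vec_mx (ratrM v).
Proof. by apply: (can_inj mxvecK); rewrite -map_mxvec !vec_mxK. Qed.

Let trdot (v : 'rV[rat]_(n * n)) (M : 'M[R]_n) : M^T = M ->
  \tr (ratrM (vec_mx v) *m M) = (mxvec M *m (ratrM v)^T) 0 0.
Proof.
move=> Msym; rewrite -[v in RHS]vec_mxK map_mxvec mxvec_dot.
by rewrite -mxtrace_tr trmx_mul Msym.
Qed.

Let T := @transpose_mx rat n.

Let vec_sym (v : 'rV[rat]_(n * n)) : v *m (1%:M - T) = 0 -> (vec_mx v)^T = vec_mx v.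
Proof.
rewrite mulmxBr mulmx1 -{2}[v]vec_mxK mul_transpose_mx => /eqP.
by rewrite subr_eq0 => /eqP vE; apply: (can_inj mxvecK); rewrite -vE vec_mxK.
Qed.

Let P := invmx Q.

Let Psym : P^T = P. Proof. by rewrite trmx_inv Q_sym. Qed.

Let invAE : (invmx A)^T *m invmx A = P.
Proof.
have QAA : Q *m ((invmx A)^T *m invmx A) = 1%:M.
  by rewrite QE mulmxA -(mulmxA A) -trmx_mul mulVmx // trmx1 mulmx1 mulmxV.
by rewrite -[LHS](mulKmx Q_unit) QAA mulmx1.
Qed.

Let sum_rows_free r (W : 'M[rat]_(r, n * n)) (y : 'I_r -> R) : row_free W ->
  \sum_i y i *: ratrM (row i W) = 0 -> forall i, y i = 0.
Proof.
move=> Wfree; pose z := \row_i y i.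
have -> : \sum_i y i *: ratrM (row i W) = z *m ratrM W.
  by rewrite mulmx_sum_row; apply: eq_bigr => i _; rewrite mxE map_row.
move/eqP; rewrite mulmx_free_eq0 ?row_free_map // => /eqP z0 i.
by have /rowP/(_ i) := z0; rewrite !mxE.
Qed.

(** [P] pairs to 1 with each row of [U] and to [n] with [Q], so the coefficients of [Q] on the rows
    sum to [n]. Hence [Q] is [n] times row 0 plus a combination of the [r.-1] differences with row
    0, and [P] pairs to 1 - 1 = 0 with each difference, which is criticality. *)
Lemma span_field r (U : 'M[rat]_(r, n * n)) (a : 'rV[R]_r) : (0 < r)%N ->
  row_free U -> U *m (1%:M - T) = 0 ->
  (forall i, (mxvec P *m (row i (ratrM U))^T) 0 0 = 1) ->
  mxvec Q = a *m ratrM U ->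
  exists S : {pred R}, [/\ divring_closed S, forall i j, Q i j \in S &
    forall y : 'I_(n.-1 ^ r.-1).+1 -> R, (forall i, y i \in S) -> rat_dependent y].
Proof.
case: r => [//|r] in U a * => _ /= Ufree Usym PU aQ.
pose E (l : 'I_r.+1) := vec_mx
  (if unlift ord0 l is Some i then row (lift ord0 i) U - row ord0 U else n%:R *: row ord0 U).
pose xl (l : 'I_r.+1) := if unlift ord0 l is Some i then a 0 (lift ord0 i) else 1.
have ES i : E (lift ord0 i) = vec_mx (row (lift ord0 i) U - row ord0 U).
  by rewrite /E liftK.
have suma : \sum_i a 0 i = n%:R.
  have : (mxvec P *m (mxvec Q)^T) 0 0 = n%:R.
    by rewrite mxvec_dot Q_sym mulVmx // mxtrace1.
  rewrite aQ trmx_mul mulmxA mxE => <-; apply: eq_bigr => i _.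
  rewrite [a^T _ _]mxE -[LHS]mul1r; congr (_ * _); rewrite -(PU i) !mxE.
  by apply: eq_bigr => j _; rewrite !mxE.
rewrite QE; apply: (@critical_point_field R n r E A xl n_gt0).
- by rewrite /xl unlift_none.
- move=> l; rewrite /E; apply: vec_sym; case: unlift => [i|].
    by rewrite mulmxBl -!row_mul Usym !row0 subrr.
  by rewrite -scalemxAl -row_mul Usym row0 scaler0.
- by [].
- rewrite -QE; apply: (can_inj mxvecK); rewrite aQ mulmx_sum_row big_ord_recl.
  rewrite /ratpencil big_ord_recl {1}/xl {1}/E unlift_none scale1r linearD linear_sum /=.
  rewrite mapvec vec_mxK map_mxZ rmorph_nat -suma big_ord_recl scalerDl -addrA map_row.
  congr (_ + _); rewrite scaler_suml -big_split; apply: eq_bigr => i _ /=.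
  rewrite linearZ /= ES mapvec vec_mxK map_mxB !map_row /xl liftK scalerBr addrC.
  by rewrite subrK.
- move=> i; rewrite -mulmxA invAE ES trdot // map_mxB linearB /= mulmxBr mxE [X in _ + X]mxE.
  by rewrite !map_row !PU subrr.
move=> y y0.
pose z (l : 'I_r.+1) := if unlift ord0 l is Some i then y i else - \sum_i y i.
have z0 : \sum_l z l *: ratrM (row l U) = 0.
  rewrite big_ord_recl {1}/z unlift_none scaleNr scaler_suml addrC -sumrB.
  apply: (can_inj vec_mxK); rewrite linear0 -[RHS]y0 linear_sum; apply: eq_bigr => i _.
  by rewrite /z liftK -scalerBr linearZ ES mapvec map_mxB.
by move=> i; have := sum_rows_free Ufree z0 (lift ord0 i); rewrite /z liftK.
Qed.

Lemma gram_field : exists (S : {pred R}) m, [/\ divring_closed S,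
  forall i j, Q i j \in S, (m <= n.-1 ^ ((n.-1 * (n + 2)) %/ 4))%N &
  forall y : 'I_m.+1 -> R, (forall i, y i \in S) -> rat_dependent y].
Proof.
have [r [U [Ufree UY YU]]] :=
  maximal_row_free (fun v => exists2 k, Y k & v = veronese k).
(* The left kernel of [G] consists of the symmetric matrices orthogonal to all rows of [U]. It is
   the direction space of the dual affine space, and [V] is a rational basis of it. *)
pose G := row_mx U^T (1%:M - T).
pose s := \rank (kermx G); pose V : 'M[rat]_(s, n * n) := row_base (kermx G).
have Usym : U *m (1%:M - T) = 0.
  apply/row_matrixP => i; rewrite row_mul row0; have [k _ ->] := UY i.
  by rewrite mulmxBr mulmx1 mul_transpose_mx trmx_mul trmxK subrr.
have VG : V *m G = 0 by apply/sub_kermxP; rewrite eq_row_base.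
have [VU VT] : V *m U^T = 0 /\ V *m (1%:M - T) = 0.
  by move: VG; rewrite mul_mx_row => /eqP; rewrite -row_mx0 => /eqP/eq_row_mx.
have Vrank : \rank V = s by rewrite eq_row_base.
have ranks : (r + s <= (n * n.+1)./2)%N.
  have -> : (r + s = \rank (col_mx U V))%N.
    rewrite -addsmxE mxrank_disjoint_sum ?Vrank ?(eqP Ufree) //.
    apply/eqP/rowV0P => u; rewrite sub_capmx => /andP[/submxP[x ux] /submxP[y uy]].
    by apply: row_dot_eq0; rewrite {1}uy ux trmx_mul mulmxA -(mulmxA y) VU mulmx0 mul0mx.
  by apply: (@symmetric_rank rat); rewrite mul_col_mx Usym VT col_mx0.
have PU i : (mxvec P *m (row i (ratrM U))^T) 0 0 = 1.
  by have [k Yk rowk] := UY i; rewrite -map_row rowk -quad Y_unit.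
have PG : mxvec P *m ratrM G = ratrM (row_mx (const_mx 1) 0).
  rewrite !map_row_mx map_mx0 map_const_mx mul_mx_row; congr row_mx.
    apply/rowP => i; rewrite mxE [RHS]mxE rmorph1 -[RHS](PU i) mxE.
    by apply: eq_bigr => j _; rewrite !mxE.
  by rewrite map_mxB map_mx1 map_transpose_mx mulmxBr mulmx1 mul_transpose_mx Psym subrr.
(* The linear system defining the dual affine space is rational and has the real solution [P], so it
   has a rational solution, which serves as base point. *)
have [p0 p0G] : exists p0 : 'rV_(n * n), p0 *m G = row_mx (const_mx 1) 0.
  suff /submxP[p0 ->] : ((row_mx (const_mx 1) 0 : 'rV_(r + n * n)) <= G)%MS by exists p0.
  by rewrite -(map_submx (ratr : {rmorphism rat -> R})) -PG submxMl.
(* By duality: a matrix orthogonal to all rows of [U] is orthogonal to every veronese vector of [Y],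
   hence to [Q] by [Y_span]. *)
have QU : (mxvec Q <= ratrM U)%MS.
  rewrite submxE; apply/eqP/rowP => j; rewrite [RHS]mxE.
  pose h := (col j (cokermx (ratrM U)))^T.
  have Uh : ratrM U *m h^T = 0 by rewrite trmxK colE mulmxA mulmx_coker mul0mx.
  have -> : (mxvec Q *m cokermx (ratrM U)) 0 j = (mxvec Q *m h^T) 0 0.
    by rewrite trmxK !mxE; apply: eq_bigr => i _; rewrite [in RHS]mxE.
  rewrite -[h]vec_mxK mxvec_dot -mxtrace_tr trmx_mul trmxK Q_sym; apply: Y_span.
  move=> k Yk; rewrite quad vec_mxK.
  have /submxP[z vz] : (veronese k <= U)%MS by apply: YU; exists k.
  by rewrite vz map_mxM trmx_mul mulmxA -[h]trmxK -trmx_mul Uh trmx0 mul0mx mxE.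
have /submxP[a aQ] := QU.
have r_gt0 : (0 < r)%N.
  rewrite lt0n; apply: contraTneq n_gt0 => r0; rewrite -leqNgt -(mxrank_unit Q_unit).
  have : \rank (mxvec Q) == 0%N.
    by rewrite -leqn0 (leq_trans (mxrankS QU)) // -r0 rank_leq_row.
  by rewrite mxrank_eq0 mxvec_eq0 => /eqP->; rewrite mxrank0.
(* For [n = 1] the base is 0 and monotonicity fails, but then the exponent bound is 0 and both sides
   are 0 ^ 0 = 1. *)
have expn_bound k : (k <= (n.-1 * (n + 2)) %/ 4)%N ->
    (n.-1 ^ k <= n.-1 ^ ((n.-1 * (n + 2)) %/ 4))%N.
  by case: (n) n_gt0 => [//|[_ /=|l _ kl]]; [rewrite leqn0 => /eqP->|rewrite leq_pexp2l].
(* The dimensions [r.-1] and [s] add up to at most n (n + 1) / 2 - 1 = (n - 1) (n + 2) / 2, the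
   affine condition having saved one; the smaller is at most half of this, rounded down. *)
have cases : (r.-1 <= (n.-1 * (n + 2)) %/ 4)%N \/ (s <= (n.-1 * (n + 2)) %/ 4)%N.
  by case: (n) n_gt0 ranks => [//|n' _]; rewrite /=; clear -r_gt0; nia.
have [/expn_bound small|/expn_bound small] := cases.
  have [S [clS SQ Sdep]] := span_field r_gt0 Ufree Usym PU aQ.
  by exists S, (n.-1 ^ r.-1)%N.
(* The dual case: [P] is the matrix [B *m B^T] on the affine space through [p0] with directions [V].
   Its inverse is [Q], which is orthogonal to these directions by [Y_span]. *)
pose B := (invmx A)^T.
have BB : B *m B^T = P by rewrite trmxK invAE.
pose E (l : 'I_s.+1) := vec_mx (if unlift ord0 l is Some i then row i V else p0).
have /submxP[y yE] : (mxvec P - ratrM p0 <= ratrM V)%MS.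
  apply: submx_trans (_ : ratrM (kermx G) <= _)%MS; last by rewrite map_submx eq_row_base.
  by rewrite map_kermx; apply/sub_kermxP; rewrite mulmxBl PG -map_mxM p0G subrr.
pose xl (l : 'I_s.+1) := if unlift ord0 l is Some i then y 0 i else 1.
have [||||||S [clS SP Sdep]] := @critical_point_field R n s E B xl n_gt0.
- by rewrite /xl unlift_none.
- move=> l; rewrite /E; case: unliftP => [i|] _; apply: vec_sym.
    by rewrite -row_mul VT row0.
  by move: p0G; rewrite mul_mx_row => /eq_row_mx[].
- by rewrite unitmx_tr unitmx_inv.
- apply: (can_inj mxvecK); rewrite BB /ratpencil big_ord_recl linearD linear_sum /=.
  rewrite {1}/xl {1}/E unlift_none scale1r mapvec vec_mxK.
  rewrite -[RHS](subrK (ratrM p0)) yE addrC mulmx_sum_row; congr (_ + _).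
  apply: eq_bigr => i _.
  by rewrite linearZ /= /E liftK mapvec vec_mxK map_row /xl liftK.
- move=> i; rewrite -mulmxA; have -> : (invmx B)^T *m invmx B = Q.
    by rewrite /B -trmx_inv invmxK trmxK -QE.
  apply: Y_span => k Yk; rewrite quad /E liftK mapvec vec_mxK map_trmx -map_mxM.
  have /submxP[z ->] : (veronese k <= U)%MS by apply: YU; exists k.
  by rewrite trmx_mul mulmxA -row_mul VU row0 mul0mx map_mx0 mxE.
- move=> w w0; apply: (@sum_rows_free s V); first by rewrite /row_free Vrank.
  apply: (can_inj vec_mxK); rewrite linear0 -[RHS]w0 linear_sum; apply: eq_bigr => i _.
  by rewrite linearZ /E liftK mapvec.
have PS k l : P k l \in S by rewrite -BB.
exists S, (n.-1 ^ s)%N; split=> // i j.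
by rewrite -[Q]invmxK; apply: divring_closed_invmx clS PS i j.
Qed.

End GramField.

(** * Averages over grids *)

Section GridAverage.
Variables (R : realType) (n : nat) (L : 'M[R]_n).
Implicit Types (u h : 'rV[R]_n -> R) (x v : 'rV[R]_n).

Definition lperiodic (T : Type) (u : 'rV[R]_n -> T) : Prop :=
  forall x a, u (x + row a L) = u x.

(* The points of (N + 1)^-1 Lambda in a fundamental domain of Lambda. *)
Definition gridpt N (j : {ffun 'I_n -> 'I_N.+1}) : 'rV[R]_n :=
  (\row_a ((j a)%:R / N.+1%:R)) *m L.

(** A Riemann sum standing for the normalized integral over the torus. It is exactly invariant under
    translation by one grid step, which is what makes integration by parts accessible. *)
Definition avg u N : R := (\sum_j u (@gridpt N j)) / (N.+1 ^ n)%:R.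

Lemma avgD u h N : avg (fun x => u x + h x) N = avg u N + avg h N.
Proof. by rewrite /avg big_split mulrDl. Qed.

Lemma avgZ c u N : avg (fun x => c * u x) N = c * avg u N.
Proof. by rewrite /avg -mulr_sumr mulrA. Qed.

Lemma avgB u h N : avg (fun x => u x - h x) N = avg u N - avg h N.
Proof. by rewrite /avg sumrB mulrBl. Qed.

Lemma avg_sum (J : Type) (r : seq J) (u : J -> 'rV[R]_n -> R) N :
  avg (fun x => \sum_(j <- r) u j x) N = \sum_(j <- r) avg (u j) N.
Proof. by rewrite /avg exchange_big mulr_suml. Qed.

Lemma avg_const c N : avg (fun=> c) N = c.
Proof.
rewrite /avg sumr_const card_ffun !card_ord -[c *+ _]mulr_natr mulfK //.
Qed.

Lemma avg_ge u h N : (forall j, u (@gridpt N j) <= h (gridpt j)) -> avg u N <= avg h N.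
Proof. by move=> uh; rewrite ler_wpM2r ?invr_ge0 ?ler0n // ler_sum. Qed.

Lemma avg_norm_le u e N : (forall j, `|u (@gridpt N j)| <= e) -> `|avg u N| <= e.
Proof.
move=> ue; rewrite ler_norml; apply/andP; split.
  by rewrite -[leLHS](avg_const _ N); apply: avg_ge => j; have := ue j;
    rewrite ler_norml => /andP[].
by rewrite -[leRHS](avg_const e N); apply: avg_ge => j; have := ue j;
  rewrite ler_norml => /andP[].
Qed.

(** The shift rotates the [a]-th index cyclically; where the index wraps around, the point changes
    by the period [row a L]. *)
Lemma avg_shift u a N : lperiodic u ->
  avg (fun x => u (x + N.+1%:R^-1 *: row a L)) N = avg u N.
Proof.
move=> per; congr (_ / _).
pose sh (j : {ffun 'I_n -> 'I_N.+1}) : {ffun 'I_n -> 'I_N.+1} :=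
  [ffun b => if b == a then ordS (j b) else j b].
pose sh' (j : {ffun 'I_n -> 'I_N.+1}) : {ffun 'I_n -> 'I_N.+1} :=
  [ffun b => if b == a then ord_pred (j b) else j b].
have shK : cancel sh sh'.
  by move=> j; apply/ffunP => b; rewrite !ffunE; case: eqP => // _; rewrite ordSK.
have shK' : cancel sh' sh.
  by move=> j; apply/ffunP => b; rewrite !ffunE; case: eqP => // _; rewrite ord_predK.
rewrite [RHS](reindex sh) /=; last by exists sh' => ? _; [exact: shK|exact: shK'].
apply: eq_bigr => j _.
have step b : b != a -> sh j b = j b by move=> /negPf ba; rewrite ffunE ba.
have delta_row : delta_mx 0 a *m L = row a L by rewrite rowE.
have [jN|jN] := eqVneq (j a : nat) N.
  have -> : gridpt j + N.+1%:R^-1 *: row a L = gridpt (sh j) + row a L; last exact: per.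
  rewrite -delta_row scalemxAl -!mulmxDl; congr (_ *m L); apply/rowP => b; rewrite !mxE.
  have [->|ba] := eqVneq b a; last first.
    by rewrite step // andbF !mulr0 !addr0.
  rewrite ffunE !eqxx /= jN modnn mul0r add0r mulr1 -{2}[_^-1]mul1r -mulrDl natr1.
  by rewrite divff // pnatr_eq0.
congr u; rewrite -delta_row scalemxAl -mulmxDl; congr (_ *m L); apply/rowP => b; rewrite !mxE.
have [->|ba] := eqVneq b a; last by rewrite step // andbF mulr0 addr0.
rewrite ffunE !eqxx /= mulr1 modn_small; last first.
  by rewrite ltnS ltn_neqAle jN /= -ltnS.
by rewrite -[(j a).+1%:R]natr1 mulrDl mul1r.
Qed.

Definition unit_cube : set 'rV[R]_n := [set y | forall i, 0 <= y 0 i <= 1].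

Lemma cube_compact : compact unit_cube.
Proof.
have -> : unit_cube = [set v : 'rV[R]_n | forall i, `[0, 1]%classic (v ord0 i)].
  by apply/seteqP; split => y /= H i; have := H i; rewrite in_itv.
by apply: (@rV_compact R n (fun=> `[0, 1]%classic)) => i; exact: segment_compact.
Qed.

Lemma continuous_mulmxr m k (M : 'M[R]_(m, k)) : continuous (fun y : 'rV[R]_m => y *m M).
Proof.
have -> : (fun y : 'rV[R]_m => y *m M) = fun y => \sum_a y 0 a *: row a M.
  by apply/funext => y; rewrite mulmx_sum_row.
elim: (index_enum _) => [|a r IH].
  by under eq_fun do rewrite big_nil; exact: cst_continuous.
under eq_fun do rewrite big_cons.
by move=> y; exact: cvgD (cvgZr_tmp (@coord_continuous _ _ _ 0 a y)) (IH y).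
Qed.

(** Uniform continuity in the base point: the estimate holds near each point of the cube, hence on
    all of it by compactness. *)
Lemma uniform_on_cube u v e : continuous u -> 0 < e ->
  exists2 d, 0 < d & forall y s, unit_cube y -> 0 <= s < d ->
    `|u (y *m L + s *: v) - u (y *m L)| < e.
Proof.
move=> uC e0.
have : \forall s \near (0 : R), unit_cube `<=`
    (fun y => `|u (y *m L + s *: v) - u (y *m L)| < e).
  apply: ((compact_near_coveringP _).1 cube_compact R (nbhs (0 : R))
    (fun s y => `|u (y *m L + s *: v) - u (y *m L)| < e) _) => y _.
  pose F := filter_prod (nbhs y) (nbhs (0 : R)).
  have c1 : (fun p : 'rV[R]_n * R => p.1 *m L) @ F --> y *m L.
    exact: (cvg_comp fst (fun y => y *m L) cvg_fst (@continuous_mulmxr _ _ L y)).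
  have c2 : (fun p : 'rV[R]_n * R => p.1 *m L + p.2 *: v) @ F --> y *m L.
    have c2' : (fun p : 'rV[R]_n * R => p.2 *: v) @ F --> (0 : R) *: v.
      by apply: cvgZr_tmp; exact: cvg_snd.
    have := cvgD c1 c2'; rewrite scale0r addr0; apply.
  have c3 : (fun p : 'rV[R]_n * R => u (p.1 *m L + p.2 *: v) - u (p.1 *m L)) @ F --> (0 : R).
    rewrite -(subrr (u (y *m L))); apply: cvgB.
      exact: (cvg_comp _ u c2 (uC _)).
    exact: (cvg_comp _ u c1 (uC _)).
  move/cvgrPdist_lt/(_ e e0): c3; apply: filterS => p.
  by rewrite sub0r normrN.
move=> /nbhs_ballP[d /= d0 Hd]; exists d => // y s Cy /andP[s0 sd].
by apply: (Hd s) => //; rewrite -ball_normE /= sub0r normrN ger0_norm.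
Qed.

End GridAverage.

Section Lines.
Variables (R : realType) (V : normedModType R) (h : V -> R).

Lemma is_derive_line (x v : V) (t : R) : differentiable h (x + t *: v) ->
  is_derive t (1 : R) (fun s => h (x + s *: v)) ('D_v h (x + t *: v)).
Proof.
move=> hd; have E : (fun s : R => s^-1 *:
      (((fun s => h (x + s *: v)) \o shift t) (s *: 1) - h (x + t *: v)))
    = (fun s : R => s^-1 *: ((h \o shift (x + t *: v)) (s *: v) - h (x + t *: v))).
  apply/funext => s /=; congr (_ *: (h _ - _)).
  by rewrite [s *: 1]mulr1 scalerDl addrCA.
split; first by rewrite /derivable E; exact: diff_derivable.
by rewrite /derive E.
Qed.

Lemma mvt_line (x v : V) (t : R) : (forall y, differentiable h y) -> 0 < t ->
  exists2 s, 0 < s < t & h (x + t *: v) - h x = t * 'D_v h (x + s *: v).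
Proof.
move=> hd t0; have D s := @is_derive_line x v s (hd _).
have cont : {within `[0, t], continuous (fun s => h (x + s *: v))}.
  by apply: derivable_within_continuous => s _; have [] := D s.
have [s] := @MVT R (fun s => h (x + s *: v)) _ 0 t t0 (fun s _ => D s) cont.
rewrite in_itv /= => st; rewrite scale0r addr0 subr0 mulrC => E.
by exists s.
Qed.

End Lines.

Section AverageDerive.
Variables (R : realType) (n : nat) (L : 'M[R]_n).
Hypothesis L_unit : L \in unitmx.
Implicit Types (u h : 'rV[R]_n -> R) (x v : 'rV[R]_n).

Definition C1_fun h := (forall x, differentiable h x) /\
  (forall v, continuous ('D_v h)).

Lemma derive_lperiodic h v : lperiodic L h -> lperiodic L ('D_v h).
Proof.
move=> per x a.
have E : (fun s : R => s^-1 *: ((h \o shift (x + row a L)) (s *: v) - h (x + row a L)))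
    = (fun s : R => s^-1 *: ((h \o shift x) (s *: v) - h x)).
  by apply/funext => s /=; rewrite addrA !per.
by rewrite /derive E.
Qed.

(** The integral of a derivative over a closed torus is 0. The difference quotient [q] over one grid
    step has average exactly 0, and by the mean value theorem it is uniformly close to the
    derivative on the grid. *)
Lemma avg_derive_row h a : C1_fun h -> lperiodic L h ->
  avg L ('D_(row a L) h) @ \oo --> (0 : R).
Proof.
move=> [hd hC] per; apply/cvgrPdist_lt => e e0.
have e20 : 0 < e / 2 by rewrite divr_gt0.
have [d d0 Hd] := uniform_on_cube L (row a L) (hC (row a L)) e20.
have : \forall N \near \oo, N.+1%:R^-1 < d.
  have /cvgrPdist_lt/(_ d d0) := @cvg_harmonic R.
  by apply: filterS => N; rewrite sub0r normrN ger0_norm ?invr_ge0.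
apply: filterS => N Nd; rewrite sub0r normrN.
pose q x := N.+1%:R * (h (x + N.+1%:R^-1 *: row a L) - h x).
have q0 : avg L q N = 0 by rewrite avgZ avgB avg_shift // subrr mulr0.
rewrite -[avg _ _ _]subr0 -q0 -avgB; apply: le_lt_trans (_ : e / 2 < e); last first.
  by rewrite ltr_pdivrMr // ltr_pMr // ltr1n.
apply: avg_norm_le => j.
have Nv : (0 : R) < N.+1%:R^-1 by rewrite invr_gt0.
have [s /andP[s0 sN] sE] := @mvt_line R _ h (gridpt L j) (row a L) _ hd Nv.
rewrite /q sE mulrA divff ?pnatr_eq0 // mul1r distrC ltW //.
apply: Hd; last by rewrite ltW //= (lt_trans sN).
move=> i; rewrite mxE divr_ge0 //= ler_pdivrMr // mul1r ler_nat.
by rewrite ltnW.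
Qed.

Lemma avg_derive h v : C1_fun h -> lperiodic L h ->
  avg L ('D_v h) @ \oo --> (0 : R).
Proof.
move=> hC per; have [hd _] := hC.
pose w := v *m invmx L.
have -> : avg L ('D_v h) = fun N => \sum_a w 0 a * avg L ('D_(row a L) h) N.
  apply/funext => N; under eq_bigr do rewrite -avgZ; rewrite -avg_sum.
  congr (avg L _ N); apply/funext => x; rewrite deriveE //.
  under eq_bigr do rewrite deriveE //.
  have -> : v = \sum_a w 0 a *: row a L by rewrite -mulmx_sum_row mulmxKV.
  by rewrite linear_sum; apply: eq_bigr => a _; rewrite linearZ.
have E0 : \sum_a w 0 a * 0 = 0 by rewrite big1 // => a _; exact: mulr0.
rewrite -[X in _ --> X]E0.
by apply: (@cvg_bigsum R nat _ \oo _ _ (fun a N => w 0 a * avg L ('D_(row a L) h) N)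
  (fun a => w 0 a * 0)) => a; exact: cvgM (cvg_cst _) (avg_derive_row _ hC per).
Qed.

Lemma deriveM_fun u h v : C1_fun u -> C1_fun h ->
  'D_v (fun x => u x * h x) = fun x => u x * 'D_v h x + h x * 'D_v u x.
Proof.
move=> [ud uC] [hd hC].
by apply/funext => x; rewrite (deriveM (f := u) (g := h)) //; exact: diff_derivable.
Qed.

Lemma C1_funM u h : C1_fun u -> C1_fun h -> C1_fun (fun x => u x * h x).
Proof.
move=> uC hC; split=> [x|v]; first by case: uC hC => ? _ [? _]; exact: differentiableM.
rewrite deriveM_fun //; case: uC hC => ud uC [hd hC].
have uc : continuous u by move=> y; exact: differentiable_continuous.
have hc : continuous h by move=> y; exact: differentiable_continuous.
move=> x.
have c1 := continuous_mul uc (hC v); have c2 := continuous_mul hc (uC v).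
exact: (@cvgD R R _ (nbhs x) _ _ _ _ _ (c1 x) (c2 x)).
Qed.

Lemma avg_by_parts u h v : C1_fun u -> C1_fun h -> lperiodic L u -> lperiodic L h ->
  (fun N => avg L (fun x => 'D_v u x * h x) N + avg L (fun x => u x * 'D_v h x) N)
    @ \oo --> (0 : R).
Proof.
move=> uC hC uper hper.
have uhper : lperiodic L (fun x => u x * h x) by move=> x a; rewrite uper hper.
have := avg_derive v (C1_funM uC hC) uhper; rewrite deriveM_fun //.
apply: cvg_trans; apply: near_eq_cvg; apply: nearW => N.
rewrite -avgD; congr (avg L _ N); apply/funext => x.
by rewrite addrC [h x * _]mulrC.
Qed.

End AverageDerive.

(** * Waves *)

Lemma cvg_sub_scale (R : realType) (u w : nat -> R) (c : R) :
  u @ \oo --> (0 : R) -> w @ \oo --> (0 : R) ->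
  (fun N => u N - c * w N) @ \oo --> (0 : R).
Proof.
move=> u0 w0; rewrite -[X in _ --> X]subr0 -[X in _ --> _ - X](mulr0 c).
exact: cvgB u0 (cvgM (cvg_cst c) w0).
Qed.

Section Waves.
Variables (R : realType) (n : nat).
Implicit Types (xi x v : 'rV[R]_n) (th : R).

Lemma dotDl x y v : dot (x + y) v = dot x v + dot y v.
Proof. by rewrite /dot mulmxDl mxE. Qed.

Lemma dotZl c x v : dot (c *: x) v = c * dot x v.
Proof. by rewrite /dot -scalemxAl mxE. Qed.

(** The phase [th] covers sines and cosines together and makes differentiation a phase shift by
    [pi / 2]. *)
Definition wave xi th x : R := cos (dot x xi + th).

Lemma dot_differentiable xi x : differentiable (fun x => dot x xi) x.
Proof.
have -> : (fun x => dot x xi) = \sum_i (fun x : 'rV[R]_n => xi 0 i *: x 0 i).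
  apply/funext => y; rewrite /dot mxE fct_sumE; apply: eq_bigr => i _.
  by rewrite mxE mulrC.
apply: differentiable_sum => i; apply: differentiableZ.
exact: differentiable_coord.
Qed.

Lemma wave_differentiable xi th x : differentiable (wave xi th) x.
Proof.
have d1 : differentiable (fun x => dot x xi + th) x.
  by apply: differentiableD; [exact: dot_differentiable|exact: differentiable_cst].
apply: (@differentiable_comp _ _ _ _ (fun x => dot x xi + th) cos) => //.
by apply/derivable1_diffP; exact: derivable_cos.
Qed.

Lemma derive_waveE xi th v x :
  'D_v (wave xi th) x = dot v xi * wave xi (th + pi / 2) x.
Proof.
have D := @is_derive_line R _ (wave xi th) x v 0 (wave_differentiable _ _ _).
rewrite scale0r addr0 in D.
have E : (fun s : R => wave xi th (x + s *: v)) =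
    (fun s : R => cos (s * dot v xi + (dot x xi + th))).
  by apply/funext => s; rewrite /wave dotDl dotZl addrAC addrC addrA.
rewrite E in D; rewrite -(@derive_val _ _ _ _ _ _ _ D).
have D2 : is_derive (0 : R) (1 : R) (fun s : R => s * dot v xi + (dot x xi + th)) (dot v xi).
  have D3 := @is_deriveD _ _ _ _ _ _ _ _ _
    (@is_deriveM _ _ _ (cst (dot v xi)) _ _ _ _
      (is_derive_id (0 : R) (1 : R)) (is_derive_cst (dot v xi) (0 : R) (1 : R)))
    (is_derive_cst (dot x xi + th) (0 : R) (1 : R)).
  by apply: is_derive_eq D3 _; rewrite addr0 /= scaler0 add0r [_ *: _]mulr1.
have D4 := @is_derive1_comp _ _ _ _ _ _ (is_derive_cos _) D2.
rewrite (@derive_val _ _ _ _ _ _ _ D4) mul0r add0r.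
by rewrite /wave addrA cosDpihalf mulrC.
Qed.

Lemma derive_wave xi th v :
  'D_v (wave xi th) = fun x => dot v xi * wave xi (th + pi / 2) x.
Proof. by apply/funext => x; exact: derive_waveE. Qed.
Lemma continuous_wave xi th : continuous (wave xi th).
Proof. by move=> x; apply: differentiable_continuous; exact: wave_differentiable. Qed.

Lemma C1_fun_wave xi th : C1_fun (wave xi th).
Proof.
split=> [x|v]; first exact: wave_differentiable.
rewrite derive_wave; apply: continuous_mul; first exact: cst_continuous.
exact: continuous_wave.
Qed.

Variable L : 'M[R]_n.
Hypothesis L_unit : L \in unitmx.

(* 2 pi times the dual lattice vector with integer coordinates [k]. *)
Definition freq (k : 'rV[int]_n) : 'rV[R]_n :=
  2 * pi *: (map_mx intr k *m (invmx L)^T).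

Lemma dot_freq y k : dot (y *m L) (freq k) = 2 * pi * \sum_a y 0 a * (k 0 a)%:~R.
Proof.
rewrite /dot /freq linearZ /= -scalemxAr trmx_mul trmxK mxE mulmxA mulmxK //.
by rewrite mxE; congr (_ * _); apply: eq_bigr => a _; rewrite !mxE.
Qed.

Lemma cosD2piz (m : int) (z : R) : cos (z + 2 * pi * m%:~R) = cos z.
Proof.
have per (k : nat) (y : R) : cos (y + 2 * pi * k%:R) = cos y.
  by rewrite mulr_natr mulr_natl periodicn //; exact: cosD2pi.
case: m => k; first exact: per.
by rewrite NegzE mulrNz mulrN -[LHS](per k.+1) subrK.
Qed.

Lemma lperiodic_wave k th : lperiodic L (wave (freq k) th).
Proof.
move=> x a; rewrite /wave dotDl rowE dot_freq (bigD1 a) //= mxE !eqxx mul1r.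
rewrite big1 ?addr0 => [|b /negPf ba]; last by rewrite mxE ba mul0r.
by rewrite addrAC cosD2piz.
Qed.

(** Two integrations by parts, each shifting the phase by [pi / 2]; the total shift by [pi] produces
    the sign. In the limit, differentiation along [v] and [w] multiplies a Fourier coefficient by -
    (v . xi) (w . xi). *)
Lemma avg_second_derive u v w k th :
  C1_fun u -> C1_fun ('D_w u) -> lperiodic L u ->
  (fun N => avg L (fun x => 'D_v ('D_w u) x * wave (freq k) th x) N
    + dot v (freq k) * dot w (freq k) * avg L (fun x => u x * wave (freq k) th x) N)
  @ \oo --> (0 : R).
Proof.
move=> uC duC per; set xi := freq k.
have H1 := avg_by_parts L_unit v duC (C1_fun_wave xi th)
  (derive_lperiodic w per) (@lperiodic_wave k th).
have H2 := avg_by_parts L_unit w uC (C1_fun_wave xi (th + pi / 2)) per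
  (@lperiodic_wave k _).
have := cvg_sub_scale (dot v xi) H1 H2.
apply: cvg_trans; apply: near_eq_cvg; apply: nearW => N /=.
have E1 : avg L (fun x => 'D_w u x * 'D_v (wave xi th) x) N
   = dot v xi * avg L (fun x => 'D_w u x * wave xi (th + pi / 2) x) N.
  by rewrite -avgZ; congr (avg L _ N); apply/funext => x; rewrite derive_waveE mulrCA.
have E2 : avg L (fun x => u x * 'D_w (wave xi (th + pi / 2)) x) N
   = - dot w xi * avg L (fun x => u x * wave xi th x) N.
  rewrite -avgZ; congr (avg L _ N); apply/funext => x.
  rewrite derive_waveE /wave -[th + _ + _]addrA -splitr addrA cosDpi; ring.
by rewrite E1 E2; ring.
Qed.

End Waves.

Lemma count_ord_le (R : realFieldType) (M : nat) (c : R) : c <= M%:R ->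
  c <= \sum_(i < M) (i%:R <= c)%R%:R.
Proof.
elim: M => [|M IH] cM; first by rewrite big_ord0.
rewrite big_ord_recr /=; have [Mc|cM'] := leP M%:R c; last by rewrite addr0 IH // ltW.
rewrite (eq_bigr (fun=> 1)) => [|i _]; last first.
  by rewrite (le_trans _ Mc) // ler_nat ltnW.
by rewrite sumr_const card_ord natr1.
Qed.

(** * Completeness of the waves *)

Section Uniqueness.
Variables (R : realType) (n : nat) (L : 'M[R]_n).
Hypothesis L_unit : L \in unitmx.
Hypothesis n_gt0 : (0 < n)%N.
Local Notation avg := (avg L).
Local Notation gridpt := (gridpt L).

(** In each coordinate at least [del * N.+1] indices qualify, index 0 included, so the bound holds
    for every [N] without an error term. *)
Lemma avg_corner del N : 0 <= del <= 1 ->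
  del ^+ n <= (\sum_(j : {ffun 'I_n -> 'I_N.+1})
    [forall a, ((j a)%:R / N.+1%:R <= del)%R]%:R) / (N.+1 ^ n)%:R :> R.
Proof.
move=> /andP[del0 del1].
have N0 : (0 : R) < N.+1%:R by rewrite ltr0n.
have -> : \sum_(j : {ffun 'I_n -> 'I_N.+1}) [forall a, ((j a)%:R / N.+1%:R <= del)%R]%:R
    = \prod_(a < n) \sum_(i < N.+1) (i%:R <= del * N.+1%:R)%R%:R :> R.
  rewrite bigA_distr_bigA /=; apply: eq_bigr => j _.
  have [/forallP H|/forallPn[a Ha]] :=
      boolP [forall a, ((j a)%:R / N.+1%:R <= del)%R].
    by rewrite big1 // => a _; rewrite -ler_pdivrMr // H.
  by rewrite (bigD1 a) //= -ler_pdivrMr // (negPf Ha) mul0r.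
rewrite prodr_const card_ord ler_pdivlMr ?ltr0n ?expn_gt0 // natrX -exprMn.
rewrite lerXn2r ?nnegrE ?mulr_ge0 ?sumr_ge0 //.
by apply: count_ord_le; rewrite ler_piMl // ltW.
Qed.

Let e_ a : 'rV[int]_n := delta_mx 0 a.

(** A trigonometric polynomial with values in [0, 1] that equals 1 exactly at the lattice points. *)
Definition peak x : R := n%:R^-1 * \sum_a (1 + wave (freq L (e_ a)) 0 x) / 2.

Lemma peak_mulmx y : peak (y *m L) = n%:R^-1 * \sum_a (1 + cos (2 * pi * y 0 a)) / 2.
Proof.
congr (_ * _); apply: eq_bigr => a _; rewrite /wave addr0 dot_freq // (bigD1 a) //=.
rewrite mxE !eqxx mulr1 big1 ?addr0 // => b /negPf ba.
by rewrite mxE ba andbF mulr0.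
Qed.

Lemma peak_bounds x : 0 <= peak x <= 1.
Proof.
have H a : 0 <= (1 + wave (freq L (e_ a)) 0 x) / 2 <= 1.
  by have := cos_geN1 (dot x (freq L (e_ a)) + 0); have := cos_le1 (dot x (freq L (e_ a)) + 0);
    rewrite /wave; lra.
rewrite /peak; apply/andP; split.
  by rewrite mulr_ge0 ?invr_ge0 ?ler0n ?sumr_ge0 // => a _; case/andP: (H a).
rewrite ler_pdivrMl ?ltr0n // mulr1 -[in leRHS](card_ord n) -sumr_const ler_sum // => a _.
by case/andP: (H a).
Qed.

Lemma peak_eq1 y : peak (y *m L) = 1 -> forall a, cos (2 * pi * y 0 a) = 1.
Proof.
rewrite peak_mulmx => E a.
have nz : (n%:R : R) != 0 by rewrite pnatr_eq0 -lt0n.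
have S0 : \sum_b (1 - cos (2 * pi * y 0 b)) = 0.
  have : \sum_b (1 + cos (2 * pi * y 0 b)) / 2 = n%:R.
    by rewrite -[LHS](mulVKf nz) E mulr1.
  rewrite -mulr_suml => E2.
  have -> : \sum_b (1 - cos (2 * pi * y 0 b)) =
     2 * n%:R - \sum_b (1 + cos (2 * pi * y 0 b)).
    rewrite -[X in 2 * X%:R](card_ord n) mulr_natr -sumr_const -sumrB.
    by apply: eq_bigr => b _; lra.
  lra.
have /eqP := S0; rewrite psumr_eq0 => [/allP/(_ a (mem_index_enum _))/eqP|b _].
  by lra.
by rewrite subr_ge0 cos_le1.
Qed.

Lemma continuous_peak : continuous peak.
Proof.
apply: continuous_mul; first exact: cst_continuous.
apply: continuous_bigsum => a; apply: continuous_mul; last exact: cst_continuous.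
by move=> x; exact: cvgD (cvg_cst _) (@continuous_wave _ _ _ _ x).
Qed.

Lemma wave_mul k a th x : wave (freq L (e_ a)) 0 x * wave (freq L k) th x =
  (wave (freq L (k + e_ a)) th x + wave (freq L (k - e_ a)) th x) / 2.
Proof.
have freqD b : dot x (freq L (k + b)) = dot x (freq L k) + dot x (freq L b).
  rewrite -[x](mulmxKV L_unit) !dot_freq // -mulrDr -big_split; congr (_ * _).
  by apply: eq_bigr => i _; rewrite [(k + b) 0 i]mxE intrD mulrDr.
have freqN b : dot x (freq L (- b)) = - dot x (freq L b).
  rewrite -[x](mulmxKV L_unit) !dot_freq // -mulrN -sumrN; congr (_ * _).
  by apply: eq_bigr => i _; rewrite [(- b) 0 i]mxE intrN mulrN.
rewrite /wave !freqD freqN addr0.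
set A := dot x (freq L k); set B := dot x _.
have -> : A + B + th = (A + th) + B by ring.
have -> : A - B + th = (A + th) - B by ring.
by rewrite (cosD (A + th) B) (cosB (A + th) B); field.
Qed.

Lemma peak_mul_wave k th x : peak x * wave (freq L k) th x =
  \sum_a n%:R^-1 / 2 * (wave (freq L k) th x +
    2^-1 * (wave (freq L (k + e_ a)) th x + wave (freq L (k - e_ a)) th x)).
Proof.
rewrite /peak -mulrA mulr_suml mulr_sumr; apply: eq_bigr => a _.
rewrite -[2^-1 * (_ + _)]mulrC -wave_mul; ring.
Qed.

(** Multiplying a wave by [peak] gives a combination of waves with the same or neighbouring
    frequencies, so orthogonality to all waves persists under multiplication by powers of [peak]. *)
Lemma avg_peak_eq0 (g : 'rV[R]_n -> R) :
  (forall k th, avg (fun x => g x * wave (freq L k) th x) @ \oo --> (0 : R)) ->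
  forall m k th, avg (fun x => g x * peak x ^+ m * wave (freq L k) th x) @ \oo --> (0 : R).
Proof.
move=> H; elim=> [|m IH] k th.
  apply: cvg_trans (H k th); apply: near_eq_cvg; apply: nearW => N.
  by congr (avg _ N); apply/funext => x; rewrite expr0 mulr1.
pose G k x := g x * peak x ^+ m * wave (freq L k) th x.
have E : avg (fun x => g x * peak x ^+ m.+1 * wave (freq L k) th x) =
    fun N => \sum_a (n%:R^-1 / 2) *
      (avg (G k) N + 2^-1 * (avg (G (k + e_ a)) N + avg (G (k - e_ a)) N)).
  apply/funext => N; under eq_bigr do rewrite -avgD -avgZ -avgD -avgZ.
  rewrite -avg_sum; congr (avg _ N); apply/funext => x.
  rewrite exprSr mulrA -mulrA peak_mul_wave mulr_sumr; apply: eq_bigr => a _.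
  by rewrite /G; ring.
rewrite E.
have E0 : \sum_(a < n) (n%:R^-1 / 2) * (0 + 2^-1 * (0 + 0)) = 0 :> R.
  by rewrite big1 // => a _; rewrite !(addr0, mulr0).
rewrite -[X in _ --> X]E0.
apply: (@cvg_bigsum R nat _ \oo _ _ (fun a N => n%:R^-1 / 2 *
  (avg (G k) N + 2^-1 * (avg (G (k + e_ a)) N + avg (G (k - e_ a)) N)))) => a.
exact: cvgM (cvg_cst _) (cvgD (IH _ _) (cvgM (cvg_cst _) (cvgD (IH _ _) (IH _ _)))).
Qed.

Lemma lperiodic_corner (T : Type) (g : 'rV[R]_n -> T) (y : 'rV[R]_n) :
  lperiodic L g -> (forall a, y 0 a = 0 \/ y 0 a = 1) -> g (y *m L) = g 0.
Proof.
move=> per y01; rewrite mulmx_sum_row; elim: (index_enum _) => [|a r IH].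
  by rewrite big_nil.
rewrite big_cons addrC; have [->|->] := y01 a; first by rewrite scale0r addr0.
by rewrite scale1r per.
Qed.

Lemma cos_2pi_eq1 (y : R) : 0 <= y <= 1 -> cos (2 * pi * y) = 1 -> y = 0 \/ y = 1.
Proof.
move=> /andP[y0 y1] cy; have pi0 : 0 < pi :> R := pi_gt0 R.
have half (z : R) : 0 <= z <= 2^-1 -> cos (2 * pi * z) = 1 -> z = 0.
  move=> /andP[z0 z1] cz; have : 2 * pi * z = 0.
    apply: cos_inj; last by rewrite cos0.
      have h1 : 0 <= pi * z by rewrite mulr_ge0 ?pi_ge0.
      have h2 : 0 <= pi * (2^-1 - z) by rewrite mulr_ge0 ?subr_ge0 ?pi_ge0.
      by rewrite in_itv /=; apply/andP; split; lra.
    by rewrite in_itv /= lexx pi_ge0.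
  by move=> /eqP; rewrite !mulf_eq0 pnatr_eq0 (gt_eqF pi0) /= => /eqP.
have [yh|yh] := leP y 2^-1; first by left; apply: half => //; rewrite y0.
right; suff : 1 - y = 0 by lra.
apply: half; first by apply/andP; split; lra.
have -> : 2 * pi * (1 - y) = - (2 * pi * y) + pi *+ 2 by ring.
by rewrite cosD2pi cosN.
Qed.

(* The powers of [peak] are trigonometric polynomials that concentrate at the
   lattice points. *)
Lemma avg_waves_gt0 (g : 'rV[R]_n -> R) : continuous g -> lperiodic L g ->
  (forall k th, avg (fun x => g x * wave (freq L k) th x) @ \oo --> (0 : R)) ->
  ~~ (0 < g 0).
Proof.
move=> gC per H; apply/negP => g0.
pose gL y := g (y *m L); pose bL y := peak (y *m L).
have gLC : continuous gL.
  move=> y; exact: (cvg_comp (fun y : 'rV[R]_n => y *m L) g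
    (@continuous_mulmxr _ _ _ L y) (gC _)).
have bLC : continuous bL.
  move=> y; exact: (cvg_comp (fun y : 'rV[R]_n => y *m L) peak
    (@continuous_mulmxr _ _ _ L y) (@continuous_peak _)).
have cubeC : compact (@unit_cube R n) by exact: cube_compact.
(* The compact part of the cube where [g] need not be large. By periodicity it contains no corner,
   so [peak] stays below some [rho < 1] on it. *)
pose Bad := @unit_cube R n `&` [set y | gL y <= g 0 / 2].
have BadC : compact Bad.
  apply: compact_closedI => //.
  apply: (@closed_comp _ _ gL [set z | z <= g 0 / 2]); first by move=> x _; exact: gLC.
  exact: closed_le.
have [rho /andP[rho0 rho1] rhoP] : exists2 rho, 0 <= rho < 1 & forall y, Bad y -> bL y <= rho.
  have [Bad0|Bad0] := pselect (Bad !=set0); last first.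
    by exists 0; rewrite ?lexx //= => y By; case: Bad0; exists y.
  have [c /set_mem[cc cBad] cmax] : exists2 c, c \in Bad & forall y, y \in Bad -> bL y <= bL c.
    by apply: EVT_max_rV => //; exact: continuous_subspaceT.
  exists (bL c); last by move=> y By; apply: cmax; exact: mem_set.
  have /andP[b0 b1] := peak_bounds (c *m L); rewrite b0 /= lt_neqAle b1 andbT.
  apply/eqP => bc1; move: cBad => /=; rewrite /gL lperiodic_corner //; first by lra.
  by move=> a; apply: cos_2pi_eq1; [exact: cc|exact: peak_eq1].
(* Midway between [rho] and 1, so that [peak] is at least [sig > rho] on a small box at the corner
   0. *)
pose sig := (1 + rho) / 2.
have bL0 : bL 0 = 1.
  rewrite /bL peak_mulmx (eq_bigr (fun=> 1)) => [|a _]; last first.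
    by rewrite mxE mulr0 cos0; lra.
  by rewrite sumr_const card_ord mulVf // pnatr_eq0 -lt0n.
have gL0 : gL 0 = g 0 by rewrite /gL mul0mx.
have [del /andP[del0 del1] delP] : exists2 del, 0 < del <= 1 &
    forall y : 'rV[R]_n, (forall a, 0 <= y 0 a <= del) -> g 0 / 2 <= gL y /\ sig <= bL y.
  have near1 : \forall y \near (0 : 'rV[R]_n), g 0 / 2 <= gL y.
    by apply: (cvgr_ge _ (gLC 0)); rewrite gL0; lra.
  have near2 : \forall y \near (0 : 'rV[R]_n), sig <= bL y.
    by apply: (cvgr_ge _ (bLC 0)); rewrite bL0 /sig; lra.
  have : \forall y \near (0 : 'rV[R]_n), g 0 / 2 <= gL y /\ sig <= bL y.
    exact: filterI near1 near2.
  move=> /nbhs_ballP[e /= e0 He].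
  exists (Num.min 1 (e / 2)); first by rewrite lt_min ltr01 divr_gt0 //= ge_min lexx.
  move=> y ye; apply: He; split=> // i a; rewrite ord1 mxE; have := ye a.
  rewrite le_min => /and3P[y0 _ ye2].
  rewrite -ball_normE /= sub0r normrN ger0_norm // (le_lt_trans ye2) //.
  by rewrite ltr_pdivrMr // ltr_pMr // ltr1n.
have [c0 _ c0max] : exists2 c, c \in @unit_cube R n &
    forall y, y \in @unit_cube R n -> `|gL y| <= `|gL c|.
  apply: (@EVT_max_rV R _ (fun y => `|gL y|)) => //.
    by exists 0 => i; rewrite mxE lexx ler01.
  by apply: continuous_subspaceT => y; exact: cvg_norm (gLC y).
pose G := `|gL c0|.
have G0 : 0 <= G by exact: normr_ge0.
have sig0 : 0 < sig by rewrite /sig; lra.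
(* Points of the corner box contribute at least [g 0 / 2 * sig ^+ m], points of [Bad] at least
   [- G * rho ^+ m], and all others a nonnegative amount. The bound does not depend on [N]. *)
have lower m N : g 0 / 2 * sig ^+ m * del ^+ n - G * rho ^+ m
    <= avg (fun x => g x * peak x ^+ m) N.
  pose box (j : {ffun 'I_n -> 'I_N.+1}) := [forall a, ((j a)%:R / N.+1%:R <= del)%R].
  set A := g 0 / 2 * sig ^+ m; set B := G * rho ^+ m.
  have s0 := ltW sig0; have g0' : 0 <= g 0 / 2 by rewrite divr_ge0 // ltW.
  have A0 : 0 <= A by rewrite mulr_ge0 ?exprn_ge0 ?ltW // divr_gt0.
  have B0 : 0 <= B by rewrite mulr_ge0 ?exprn_ge0.
  have c0' : (N.+1 ^ n)%:R != 0 :> R by rewrite pnatr_eq0 expn_eq0.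
  apply: (@le_trans _ _ ((\sum_j (A * (box j)%:R - B)) / (N.+1 ^ n)%:R)).
    rewrite sumrB mulrBl -mulr_sumr -mulrA sumr_const card_ffun !card_ord.
    rewrite -[B *+ _]mulr_natr mulfK // lerB // ler_wpM2l //.
    by apply: avg_corner; rewrite ltW.
  rewrite ler_wpM2r ?invr_ge0 ?ler0n // ler_sum // => j _.
  set y : 'rV[R]_n := \row_a ((j a)%:R / N.+1%:R).
  have yc : unit_cube y.
    move=> i; rewrite mxE divr_ge0 //= ler_pdivrMr // mul1r ler_nat.
    by rewrite ltnW.
  rewrite -/(gL y) -/(bL y); have /andP[b0 b1] := peak_bounds (y *m L).
  have [/forallP boxj|_] := boolP (box j).
    have [gy by_] : g 0 / 2 <= gL y /\ sig <= bL y.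
      by apply: delP => a; rewrite mxE divr_ge0 //= boxj.
    rewrite mulr1 lerBlDr; apply: (@le_trans _ _ (gL y * bL y ^+ m)); last by rewrite lerDl.
    by apply: ler_pM => //; [exact: exprn_ge0|apply: lerXn2r].
  rewrite /= mulr0 sub0r; have [gy|gy] := leP (gL y) (g 0 / 2); last first.
    rewrite (@le_trans _ _ 0) ?oppr_le0 // mulr_ge0 ?exprn_ge0 // ltW //.
    by rewrite (lt_trans _ gy) // divr_gt0.
  have := rhoP y (conj yc gy) => by_.
  suff : `|gL y * bL y ^+ m| <= B by rewrite ler_norml => /andP[].
  rewrite normrM ler_pM //; first exact: c0max _ (mem_set yc).
  by rewrite ger0_norm ?exprn_ge0 // lerXn2r ?nnegrE.
(* [(rho / sig) ^+ m] tends to 0 while [del] does not depend on [m], so the corner wins for large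
   [m]. *)
have [m Hm] : exists m, 0 < g 0 / 2 * sig ^+ m * del ^+ n - G * rho ^+ m.
  have rs : 0 <= rho / sig by apply: divr_ge0 => //; exact: ltW.
  have r1 : `|rho / sig| < 1 by rewrite ger0_norm // ltr_pdivrMr // /sig; lra.
  have G1 : 0 < G + 1 by rewrite ltr_wpDl.
  pose e := g 0 / 2 * del ^+ n / (G + 1).
  have e0 : 0 < e by rewrite divr_gt0 // mulr_gt0 ?divr_gt0 ?exprn_gt0.
  have /cvgrPdist_lt/(_ e e0)/filter_ex[m] := cvg_expr r1.
  rewrite sub0r normrN ger0_norm ?exprn_ge0 // => Hm.
  exists m; rewrite subr_gt0.
  have -> : rho ^+ m = (rho / sig) ^+ m * sig ^+ m by rewrite -exprMn divfK ?gt_eqF.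
  rewrite mulrA [g 0 / 2 * _ * _]mulrAC ltr_pM2r ?exprn_gt0 //.
  move: Hm; rewrite /e ltr_pdivlMr // => Hm.
  by apply: le_lt_trans Hm; rewrite mulrC ler_wpM2l ?lerDl // exprn_ge0.
set eta := (X in 0 < X) in Hm.
have lim0 : avg (fun x => g x * peak x ^+ m) @ \oo --> (0 : R).
  have := avg_peak_eq0 H m 0 0; apply: cvg_trans; apply: near_eq_cvg; apply: nearW => N.
  congr (avg _ N); apply/funext => x; rewrite /wave -[x](mulmxKV L_unit) dot_freq //.
  by rewrite big1 ?mulr0 ?add0r ?cos0 ?mulr1 // => a _; rewrite [X in X%:~R]mxE mulr0.
have [N HN] : exists N, `|avg (fun x => g x * peak x ^+ m) N| < eta.
  have /cvgrPdist_lt/(_ _ Hm)  := lim0.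
  by move=> /filter_ex[N]; rewrite sub0r normrN => HN; exists N.
by have := lower m N; rewrite -/eta leNgt (le_lt_trans (ler_norm _) HN).
Qed.

Lemma wave_uniqueness (g : 'rV[R]_n -> R) : continuous g -> lperiodic L g ->
  (forall k th, avg (fun x => g x * wave (freq L k) th x) @ \oo --> (0 : R)) ->
  g 0 = 0.
Proof.
move=> gC per H; have := avg_waves_gt0 gC per H.
have H' : forall k th, avg (fun x => - g x * wave (freq L k) th x) @ \oo --> (0 : R).
  move=> k th.
  have -> : avg (fun x => - g x * wave (freq L k) th x) =
      fun N => - avg (fun x => g x * wave (freq L k) th x) N.
    apply/funext => N; rewrite -[RHS]mulN1r -avgZ.
    by congr (avg _ N); apply/funext => x; rewrite mulN1r mulNr.
  by rewrite -[X in _ --> X]oppr0; exact: cvgN (H k th).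
have gC' : continuous (fun x => - g x) by move=> x; exact: cvgN (gC x).
have per' : lperiodic L (fun x => - g x) by move=> x a; rewrite per.
have := avg_waves_gt0 gC' per' H'.
by rewrite oppr_gt0 -!leNgt => h1 h2; apply/eqP; rewrite eq_le h1 h2.
Qed.

End Uniqueness.

(** * Operators whose symbol vanishes on the spectrum *)

Section Symbol.
Variables (R : realType) (n : nat) (L : 'M[R]_n).
Hypothesis L_unit : L \in unitmx.
Hypothesis n_gt0 : (0 < n)%N.
Local Notation avg := (avg L).
Let e_ i : 'rV[R]_n := delta_mx 0 i.

Lemma dot_delta i (xi : 'rV[R]_n) : dot (e_ i) xi = xi 0 i.
Proof. by rewrite /dot -rowE !mxE. Qed.

Lemma quad_sum (H : 'M[R]_n) (xi : 'rV[R]_n) :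
  (xi *m H *m xi^T) 0 0 = \sum_i \sum_j H i j * (xi 0 i * xi 0 j).
Proof.
rewrite mxE exchange_big /=; apply: eq_bigr => j _.
rewrite !mxE mulr_suml; apply: eq_bigr => i _; ring.
Qed.

(** Asymptotically, the operator multiplies the coefficient of [g] at the frequency xi by - xi H
    xi^T. The eigenvalue equation kills that coefficient unless |xi| ^ 2 = c, and in the remaining
    case the symbol vanishes. So all coefficients of the image are 0, and [wave_uniqueness] gives
    its value at 0. *)
Lemma symbol_vanishing (g : 'rV[R]_n -> R) (H : 'M[R]_n) (c : R) :
  C1_fun g -> (forall v, C1_fun ('D_v g)) -> lperiodic L g ->
  (forall x, \sum_i 'D_(e_ i) ('D_(e_ i) g) x = - c * g x) ->
  (forall k, dot (freq L k) (freq L k) = c -> (freq L k *m H *m (freq L k)^T) 0 0 = 0) ->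
  \sum_i \sum_j H i j * 'D_(e_ i) ('D_(e_ j) g) 0 = 0.
Proof.
move=> gC dgC per lap Hsymb.
apply: (@wave_uniqueness R n L L_unit n_gt0
  (fun x => \sum_i \sum_j H i j * 'D_(e_ i) ('D_(e_ j) g) x)).
- apply: continuous_bigsum => i; apply: continuous_bigsum => j.
  by apply: continuous_mul; [exact: cst_continuous|have [_] := dgC (e_ j)].
- move=> x a; apply: eq_bigr => i _; apply: eq_bigr => j _.
  exact (congr1 ( *%R (H i j)) (derive_lperiodic (e_ i) (derive_lperiodic (e_ j) per) x a)).
move=> k th; set xi := freq L k in Hsymb *.
pose T i j N := avg (fun x => 'D_(e_ i) ('D_(e_ j) g) x * wave xi th x) N
    + xi 0 i * xi 0 j * avg (fun x => g x * wave xi th x) N.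
have T0 i j : T i j @ \oo --> (0 : R).
  have := @avg_second_derive R n L L_unit g (e_ i) (e_ j) k th gC (dgC _) per.
  by rewrite !dot_delta.
have sum0 (r : seq 'I_n) (C : 'I_n -> R) (u : 'I_n -> nat -> R) :
    (forall i, u i @ \oo --> (0 : R)) ->
    (fun N => \sum_(i <- r) C i * u i N) @ \oo --> (0 : R).
  move=> u0; have E0 : \sum_(i <- r) C i * 0 = 0 :> R by rewrite big1 // => i _; exact: mulr0.
  rewrite -[X in _ --> X]E0; apply: (@cvg_bigsum R nat _ \oo _ _ (fun i N => C i * u i N)) => i.
  exact: cvgM (cvg_cst _) (u0 i).
have HT0 : (fun N => \sum_i 1 * \sum_j H i j * T i j N) @ \oo --> (0 : R).
  by apply: (sum0 _ (fun=> 1) (fun i N => \sum_j H i j * T i j N)) => i; exact: sum0.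
have avgE : avg (fun x => (\sum_i \sum_j H i j * 'D_(e_ i) ('D_(e_ j) g) x) * wave xi th x) =
  fun N => (\sum_i 1 * \sum_j H i j * T i j N)
    - (xi *m H *m xi^T) 0 0 * avg (fun x => g x * wave xi th x) N.
  apply/funext => N; rewrite quad_sum mulr_suml -sumrB.
  under [RHS]eq_bigr do rewrite mul1r mulr_suml -sumrB.
  have -> : (fun x => (\sum_i \sum_j H i j * 'D_(e_ i) ('D_(e_ j) g) x) * wave xi th x) =
      fun x => \sum_i \sum_j H i j * ('D_(e_ i) ('D_(e_ j) g) x * wave xi th x).
    apply/funext => x; rewrite mulr_suml; apply: eq_bigr => i _.
    by rewrite mulr_suml; apply: eq_bigr => j _; rewrite mulrA.
  rewrite avg_sum; apply: eq_bigr => i _; rewrite avg_sum; apply: eq_bigr => j _.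
  rewrite avgZ /T; ring.
rewrite avgE.
have [xic|xic] := eqVneq (dot xi xi) c.
  rewrite Hsymb //; apply: cvg_trans HT0; apply: near_eq_cvg; apply: nearW => N.
  by rewrite mul0r subr0.
(* Summing the diagonal relations [T i i] and inserting the eigenvalue equation leaves |xi| ^ 2 - c
   times the coefficient of [g]. *)
have g0 : avg (fun x => g x * wave xi th x) @ \oo --> (0 : R).
  have := sum0 (index_enum 'I_n) (fun=> (dot xi xi - c)^-1) (fun i => T i i) (fun i => T0 i i).
  apply: cvg_trans; apply: near_eq_cvg; apply: nearW => N.
  rewrite -mulr_sumr /T big_split /=.
  have -> : \sum_i avg (fun x => 'D_(e_ i) ('D_(e_ i) g) x * wave xi th x) N
      = - c * avg (fun x => g x * wave xi th x) N.
    rewrite -avg_sum -avgZ; congr (avg _ N); apply/funext => x.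
    by rewrite -mulr_suml lap mulrA.
  have -> : \sum_i xi 0 i * xi 0 i * avg (fun x => g x * wave xi th x) N
      = dot xi xi * avg (fun x => g x * wave xi th x) N.
    by rewrite /dot [in RHS]mxE [RHS]mulr_suml; apply: eq_bigr => i _; rewrite [xi^T i 0]mxE.
  by rewrite -mulrDl [- c + _]addrC mulKf // subr_eq0.
exact: cvg_sub_scale HT0 g0.
Qed.

End Symbol.

(** * Takahashi's theorem *)

Section Schwarz.
Variables (R : realType) (V : normedModType R) (u : V -> R).

Lemma second_difference (x v w : V) (s : R) :
  (forall y, differentiable u y) -> (forall y, differentiable ('D_v u) y) -> 0 < s ->
  exists a b, [/\ 0 < a < s, 0 < b < s &
    u (x + s *: v + s *: w) - u (x + s *: v) - u (x + s *: w) + u x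
      = s * (s * 'D_w ('D_v u) (x + a *: v + b *: w))].
Proof.
move=> ud dud s0; pose phi y := u (y + s *: w) - u y.
have shiftd y : differentiable (fun y => u (y + s *: w)) y.
  by apply: (@differentiable_comp _ _ _ _ (fun y => y + s *: w) u).
have phid y : differentiable phi y by exact: differentiableB.
have Dshift y : 'D_v (fun y => u (y + s *: w)) y = 'D_v u (y + s *: w).
  have E : (fun h : R => h^-1 *:
        (((fun y => u (y + s *: w)) \o shift y) (h *: v) - u (y + s *: w)))
      = (fun h : R => h^-1 *: ((u \o shift (y + s *: w)) (h *: v) - u (y + s *: w))).
    by apply/funext => h /=; rewrite addrA.
  by rewrite /derive E.
have [a as_ aE] := mvt_line x v phid s0.
have [b bs bE] := mvt_line (x + a *: v) w dud s0.
exists a, b; split=> //; rewrite -bE.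
have <- : 'D_v phi (x + a *: v) = 'D_v u (x + a *: v + s *: w) - 'D_v u (x + a *: v).
  rewrite /phi (deriveB (f := fun y => u (y + s *: w)) (g := u)) ?Dshift //;
    exact: diff_derivable.
rewrite -aE /phi; ring.
Qed.

(** The second difference over the parallelogram spanned by [s *: v] and [s *: w] is symmetric in
    [v] and [w]. The mean value theorem, applied in either order, equates the two mixed derivatives
    at points near [x], and continuity concludes. *)
Lemma schwarz (x v w : V) :
  (forall y, differentiable u y) ->
  (forall y, differentiable ('D_v u) y) -> (forall y, differentiable ('D_w u) y) ->
  {for x, continuous ('D_w ('D_v u))} -> {for x, continuous ('D_v ('D_w u))} ->
  'D_w ('D_v u) x = 'D_v ('D_w u) x.
Proof.
move=> ud dv dw cwv cvw; apply/eqP; rewrite -subr_eq0 -normr_le0.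
apply/ler_addgt0Pr => e e0; rewrite add0r.
have e2 : 0 < e / 2 by rewrite divr_gt0.
have : \forall y \near x, `|'D_w ('D_v u) x - 'D_w ('D_v u) y| < e / 2 /\
    `|'D_v ('D_w u) x - 'D_v ('D_w u) y| < e / 2.
  by apply: filterI; [move/cvgrPdist_lt/(_ _ e2): cwv|move/cvgrPdist_lt/(_ _ e2): cvw].
move=> /nbhs_ballP[d /= d0 Hd].
have C0 : 0 < `|v| + `|w| + 1 by rewrite ltr_wpDl // addr_ge0.
(* Small enough for all intermediate points to stay in the ball of radius [d]; the summand 1 covers
   the case of zero vectors. *)
pose s := d / (`|v| + `|w| + 1).
have s0 : 0 < s by rewrite divr_gt0.
have inball a b y z : `|y| + `|z| = `|v| + `|w| -> 0 < a < s -> 0 < b < s ->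
    ball x d (x + a *: y + b *: z).
  move=> yz /andP[a0 as_] /andP[b0 bs].
  rewrite -ball_normE /= -addrA opprD addrA subrr add0r normrN.
  apply: le_lt_trans (ler_normD _ _) _; rewrite !normrZ !gtr0_norm //.
  apply: (@le_lt_trans _ _ (s * (`|v| + `|w|))).
    by rewrite -yz mulrDr lerD // ler_wpM2r // ltW.
  by rewrite /s mulrAC ltr_pdivrMr // ltr_pM2l // ltrDl.
have [a [b [as_ bs E1]]] := @second_difference x v w s ud dv s0.
have [a' [b' [as' bs' E2]]] := @second_difference x w v s ud dw s0.
have E : 'D_w ('D_v u) (x + a *: v + b *: w) = 'D_v ('D_w u) (x + a' *: w + b' *: v).
  have s0' : s != 0 by rewrite gt_eqF.
  have EE : u (x + s *: v + s *: w) - u (x + s *: v) - u (x + s *: w) + u x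
      = u (x + s *: w + s *: v) - u (x + s *: w) - u (x + s *: v) + u x.
    by rewrite [x + s *: w + s *: v]addrAC; congr (_ + _); rewrite [LHS]addrAC.
  exact (mulfI s0' (mulfI s0' (etrans (esym E1) (etrans EE E2)))).
have [h1 _] := Hd _ (inball a b v w erefl as_ bs).
have [_ h2] := Hd _ (inball a' b' w v (addrC _ _) as' bs').
rewrite E in h1.
rewrite distrC in h2.
rewrite -(subrKA ('D_v ('D_w u) (x + a' *: w + b' *: v))).
apply: le_trans (ler_normD _ _) _; rewrite [leRHS]splitr.
exact: lerD (ltW h1) (ltW h2).
Qed.

End Schwarz.

Lemma dot_sum (R : realType) k (u v : 'rV[R]_k) : dot u v = \sum_m u 0 m * v 0 m.
Proof. by rewrite /dot mxE; apply: eq_bigr => m _; rewrite mxE. Qed.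

Lemma dotC (R : realType) k (u v : 'rV[R]_k) : dot u v = dot v u.
Proof. by rewrite !dot_sum; apply: eq_bigr => m _; rewrite mulrC. Qed.

Lemma dot_suml (R : realType) k (J : Type) (r : seq J) (u : J -> 'rV[R]_k) v :
  dot (\sum_(j <- r) u j) v = \sum_(j <- r) dot (u j) v.
Proof. by rewrite /dot mulmx_suml summxE. Qed.

Section Smooth.
Variables (R : realType) (n k : nat).
Implicit Types (F G : 'rV[R]_n -> 'rV[R]_k).
Local Notation comp F m := (fun x => F x 0 m).

Lemma smooth_differentiable F : smooth F -> forall x, differentiable F x.
Proof. by move=> /(_ 1%N)[]. Qed.

Lemma smooth_partial F i : smooth F -> smooth (partial i F).
Proof. by move=> sF r; have [_] := sF r.+1; apply. Qed.

Lemma comp_differentiable F m : smooth F -> forall x, differentiable (comp F m) x.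
Proof.
move=> sF x; apply: (@differentiable_comp _ _ _ _ F (fun y => y 0 m)).
  exact: smooth_differentiable.
exact: differentiable_coord.
Qed.

Lemma derive_comp F m v x : smooth F -> 'D_v (comp F m) x = ('D_v F x) 0 m.
Proof.
move=> sF; rewrite derive_mx ?mxE //.
exact/diff_derivable/smooth_differentiable.
Qed.

Lemma derive_partials F v x : smooth F -> 'D_v F x = \sum_i v 0 i *: partial i F x.
Proof.
move=> sF; have dF := smooth_differentiable sF x; rewrite deriveE //.
rewrite [v in LHS]row_sum_delta linear_sum; apply: eq_bigr => i _.
by rewrite linearZ /= /partial deriveE.
Qed.

Lemma derive_comp_partials F m v : smooth F ->
  'D_v (comp F m) = fun x => \sum_i v 0 i * comp (partial i F) m x.
Proof.
move=> sF; apply/funext => x; rewrite derive_comp // derive_partials // summxE.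
by apply: eq_bigr => i _; rewrite mxE.
Qed.

Lemma comp_C1 F m : smooth F -> C1_fun (comp F m).
Proof.
move=> sF; split=> [x|v]; first exact: comp_differentiable.
rewrite derive_comp_partials //.
apply: continuous_bigsum => i; apply: continuous_mul; first exact: cst_continuous.
move=> x; apply: differentiable_continuous.
by apply: comp_differentiable; exact: smooth_partial.
Qed.

Lemma C1_fun_cst (c : R) : C1_fun (fun _ : 'rV[R]_n => c).
Proof.
split=> [x|w]; first exact: differentiable_cst.
have -> : 'D_w (fun=> c) = fun _ : 'rV[R]_n => (0 : R).
  by apply/funext => x; exact: derive_cst.
exact: cst_continuous.
Qed.

Lemma C1_funD (u h : 'rV[R]_n -> R) : C1_fun u -> C1_fun h -> C1_fun (fun x => u x + h x).
Proof.
move=> [ud uC] [hd hC]; split=> [x|v]; first exact: differentiableD.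
have -> : 'D_v (fun x => u x + h x) = fun x => 'D_v u x + 'D_v h x.
  by apply/funext => x; rewrite (deriveD (f := u) (g := h)) //; exact: diff_derivable.
move=> x; exact: (@cvgD R R _ (nbhs x) _ _ _ _ _ (uC v x) (hC v x)).
Qed.

Lemma derive_comp_C1 F m v : smooth F -> C1_fun ('D_v (comp F m)).
Proof.
move=> sF; rewrite derive_comp_partials //.
elim: (index_enum _) => [|i r IH].
  by under eq_fun do rewrite big_nil; exact: C1_fun_cst.
under eq_fun do rewrite big_cons.
apply: C1_funD IH; apply: C1_funM; first exact: C1_fun_cst.
by apply: comp_C1; exact: smooth_partial.
Qed.

Lemma partialE F a b y m : smooth F -> (partial a (partial b F) y) 0 m
    = 'D_(delta_mx 0 a) ('D_(delta_mx 0 b) (comp F m)) y.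
Proof.
move=> sF; rewrite -derive_comp; last exact: smooth_partial.
have -> // : (fun x => partial b F x 0 m) = 'D_(delta_mx 0 b) (comp F m).
by apply/funext => z; rewrite derive_comp.
Qed.

Lemma partialC F i j x : smooth F ->
  partial i (partial j F) x = partial j (partial i F) x.
Proof.
move=> sF; apply/rowP => m.
have [cd _] := comp_C1 m sF.
have [d1 c1] := derive_comp_C1 m (delta_mx 0 j) sF.
have [d2 c2] := derive_comp_C1 m (delta_mx 0 i) sF.
have S := @schwarz R _ (comp F m) x (delta_mx 0 j) (delta_mx 0 i) cd d1 d2
  (c1 (delta_mx 0 i) x) (c2 (delta_mx 0 j) x).
exact (etrans (@partialE F i j x m sF) (etrans S (esym (@partialE F j i x m sF)))).
Qed.

Lemma derive_dot F G i x : smooth F -> smooth G ->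
  'D_(delta_mx 0 i) (fun y => dot (F y) (G y)) x
    = dot (partial i F x) (G x) + dot (F x) (partial i G x).
Proof.
move=> sF sG.
have -> : (fun y => dot (F y) (G y)) = \sum_m ((comp F m) * (comp G m)).
  by apply/funext => y; rewrite dot_sum fct_sumE.
have dF m : derivable (comp F m) x (delta_mx 0 i).
  by apply: diff_derivable; exact: comp_differentiable.
have dG m : derivable (comp G m) x (delta_mx 0 i).
  by apply: diff_derivable; exact: comp_differentiable.
rewrite derive_sum => [|m]; last exact: derivableM.
rewrite !dot_sum -big_split; apply: eq_bigr => m _ /=.
rewrite deriveM // !derive_comp // /partial addrC.
by congr (_ + _); rewrite /GRing.scale /= mulrC.
Qed.

Lemma dot_const F G c i x : smooth F -> smooth G ->
  (forall y, dot (F y) (G y) = c) ->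
  dot (partial i F x) (G x) = - dot (F x) (partial i G x).
Proof.
move=> sF sG Hc; apply/eqP; rewrite -addr_eq0 -derive_dot //.
have -> : (fun y => dot (F y) (G y)) = cst c by apply/funext => y; rewrite Hc.
by rewrite derive_cst.
Qed.

End Smooth.

(** * Minimal isometric immersions of flat tori into spheres *)

Section Immersion.
Variables (R : realType) (n k : nat) (L : 'M[R]_n) (F : 'rV[R]_n -> 'rV[R]_k).
Hypothesis n_gt0 : (0 < n)%N.
Hypothesis L_unit : L \in unitmx.
Hypothesis F_unit : forall x, dot (F x) (F x) = 1.
Hypothesis F_smooth : smooth F.
Hypothesis F_iso : isometric F.
Hypothesis F_min : forall x, mean_curvature F x = 0.
Hypothesis F_per : lperiodic L F.

Let pF i := smooth_partial i F_smooth.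

Lemma dot_partials i j x : dot (partial i F x) (partial j F x) = (i == j)%:R.
Proof.
rewrite /partial F_iso dot_sum (bigD1 i) //= big1 => [|l li]; last first.
  by rewrite !mxE eqxx (negPf li) mul0r.
by rewrite addr0 !mxE !eqxx mul1r.
Qed.

Lemma dot_second_partial_self i j x :
  dot (partial i (partial j F) x) (F x) = - (i == j)%:R.
Proof.
have tangent y : dot (partial j F y) (F y) = 0.
  have := dot_const j y F_smooth F_smooth F_unit; rewrite [X in _ = - X]dotC => /eqP.
  by rewrite -addr_eq0 -mulr2n mulrn_eq0 /= => /eqP.
by rewrite (dot_const i x (pF j) F_smooth tangent) dotC dot_partials.
Qed.

(** The metric coefficients are constant: the product equals - <d_i F, d_j d_i F>, minus half the
    derivative of |d_i F| ^ 2 = 1 along j. This is where the symmetry of second partials enters. *)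
Lemma dot_second_partial_tangent i j x :
  dot (partial i (partial i F) x) (partial j F x) = 0.
Proof.
rewrite (dot_const i x (pF i) (pF j) (fun y => dot_partials i j y)).
rewrite (partialC i j x F_smooth) dotC.
have := dot_const j x (pF i) (pF i) (fun y => dot_partials i i y).
rewrite [X in _ = - X]dotC => /eqP; rewrite -addr_eq0 -mulr2n mulrn_eq0 /= => /eqP->.
by rewrite oppr0.
Qed.

(** The second partial d_i d_i F has no tangential part and component -1 along [F], so its normal
    part is d_i d_i F + F. Minimality makes the sum of these vanish. *)
Lemma laplacian_eigen x : \sum_i partial i (partial i F) x = - n%:R *: F x.
Proof.
have /eqP := F_min x; rewrite /mean_curvature scaler_eq0 invr_eq0 pnatr_eq0.
rewrite (gtn_eqF n_gt0) /= /second_fundamental_form /normal_part.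
under eq_bigr => i _.
  rewrite dot_second_partial_self eqxx scaleN1r opprK.
  rewrite big1 ?subr0 => [|j _]; last by rewrite dot_second_partial_tangent scale0r.
  over.
rewrite big_split /= sumr_const card_ord addr_eq0 => /eqP->.
by rewrite scaleNr scaler_nat.
Qed.

(** The operator with coefficients [H] kills each coordinate of [F] at 0. Pairing the result with
    [F 0] replaces d_i d_j F by minus the Kronecker delta, which leaves [- \tr H]. *)
Lemma immersion_trace (H : 'M[R]_n) :
  (forall z, dot (freq L z) (freq L z) = n%:R ->
    (freq L z *m H *m (freq L z)^T) 0 0 = 0) ->
  \tr H = 0.
Proof.
move=> Hsymb.
have comp0 m : \sum_i \sum_j H i j * (partial i (partial j F) 0) 0 m = 0.
  pose g x := F x 0 m.
  have lap x : \sum_i 'D_(delta_mx 0 i) ('D_(delta_mx 0 i) g) x = - n%:R * g x.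
    have /rowP/(_ m) := laplacian_eigen x; rewrite summxE [RHS]mxE => <-.
    by apply: eq_bigr => i _; exact: esym (partialE i i x m F_smooth).
  have gper : lperiodic L g by move=> x a; rewrite /g F_per.
  have := symbol_vanishing L_unit n_gt0 (comp_C1 m F_smooth)
    (fun v => derive_comp_C1 m v F_smooth) gper lap Hsymb.
  move=> E; rewrite -[RHS]E; apply: eq_bigr => i _; apply: eq_bigr => j _; congr (_ * _).
  exact: partialE.
have : \sum_i \sum_j H i j * dot (partial i (partial j F) 0) (F 0) = 0.
  under eq_bigr => i _ do under eq_bigr => j _ do rewrite -dotZl.
  under eq_bigr => i _ do rewrite -dot_suml.
  rewrite -dot_suml dot_sum big1 // => m _; rewrite summxE.
  under eq_bigr => i _ do rewrite summxE.
  under eq_bigr => i _ do under eq_bigr => j _ do rewrite mxE.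
  by rewrite comp0 mul0r.
move=> E; apply/eqP; rewrite -oppr_eq0 -[X in _ == X]E -sumrN; apply/eqP/eq_bigr => i _.
rewrite (bigD1 i) //= big1 => [|j /negPf ji]; last first.
  by rewrite dot_second_partial_self eq_sym ji oppr0 mulr0.
by rewrite dot_second_partial_self eqxx addr0 mulrN1.
Qed.

End Immersion.

Lemma torus_proj_shift (R : realType) (n : nat) (L : 'M[R]_n) (x : 'rV[R]_n) (a : 'I_n) :
  torus_proj L (x + row a L) = torus_proj L x.
Proof.
apply/eqmodP => /=; rewrite /lattice_rel; apply/mem_set; exists (delta_mx 0 a) => //.
by rewrite addrC addKr map_delta_mx -rowE.
Qed.

Lemma immersed_torus_trace (R : realType) (n : nat) (L : 'M[R]_n) :
  (0 < n)%N -> L \in unitmx ->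
  (exists (m : nat) (f : torus L -> 'rV[R]_m.+1), minimal_isometric_immersion f) ->
  forall H : 'M[R]_n,
  (forall z, dot (freq L z) (freq L z) = n%:R ->
    (freq L z *m H *m (freq L z)^T) 0 0 = 0) -> \tr H = 0.
Proof.
move=> n_gt0 L_unit [m [f [f_unit f_smooth f_iso f_min]]] H.
apply: immersion_trace n_gt0 L_unit _ f_smooth f_iso f_min _ H.
  by move=> x; exact: f_unit.
by move=> x a /=; rewrite torus_proj_shift.
Qed.

(** * From Euclidean to lattice coordinates *)

Section TorusField.
Variables (R : realType) (n : nat) (L : 'M[R]_n).
Hypothesis n_gt0 : (0 < n)%N.
Hypothesis L_unit : L \in unitmx.

Lemma freq_quad (H : 'M[R]_n) z :
  (freq L z *m (L^T *m H *m L) *m (freq L z)^T) 0 0 =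
  (2 * pi) ^+ 2 * (map_mx intr z *m H *m (map_mx intr z)^T) 0 0.
Proof.
rewrite /freq linearZ /= -scalemxAr -!scalemxAl scalerA -expr2 mxE trmx_mul trmxK.
congr (_ * fun_of_matrix _ 0 0).
have -> : map_mx intr z *m (invmx L)^T *m (L^T *m H *m L) *m (invmx L *m (map_mx intr z)^T)
  = map_mx intr z *m ((invmx L)^T *m L^T) *m H *m (L *m invmx L) *m (map_mx intr z)^T.
  by rewrite !mulmxA.
by rewrite -trmx_mul mulmxV // trmx1 !mulmx1.
Qed.

(** The scale at which the eigenvalue condition |freq z| ^ 2 = n becomes z (mu q)^-1 z^T = 1 for the
    integer vector z. *)
Let mu : R := n%:R / (2 * pi) ^+ 2.

Let mu_gt0 : 0 < mu.
Proof. by rewrite divr_gt0 ?ltr0n // exprn_gt0 // mulr_gt0 // pi_gt0. Qed.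

Lemma torus_gram_field :
  (exists (m : nat) (f : torus L -> 'rV[R]_m.+1), minimal_isometric_immersion f) ->
  exists (S : {pred R}) m, [/\ divring_closed S,
    forall i j, mu * gram L i j \in S, (m <= n.-1 ^ ((n.-1 * (n + 2)) %/ 4))%N &
    forall y : 'I_m.+1 -> R, (forall i, y i \in S) -> rat_dependent y].
Proof.
move=> immersed; pose A := Num.sqrt mu *: L; pose Q := mu *: gram L.
have A_unit : A \in unitmx by rewrite unitmxZ // unitfE sqrtr_eq0 -ltNge.
have QE : Q = A *m A^T.
  rewrite /A linearZ /= -scalemxAl -scalemxAr scalerA -expr2 sqr_sqrtr //; exact: ltW.
have invQ : invmx Q = mu^-1 *: ((invmx L)^T *m invmx L).
  have Qu : Q \in unitmx by rewrite QE unitmx_mul unitmx_tr A_unit.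
  rewrite -[LHS]mul1mx; apply: (canLR (mulmxK Qu)).
  rewrite -scalemxAl -scalemxAr scalerA mulVf ?gt_eqF // scale1r /gram.
  by rewrite mulmxA -(mulmxA _ (invmx L)) mulVmx // mulmx1 -trmx_mul mulmxV // trmx1.
pose Y (k : 'rV[rat]_n) := exists2 z : 'rV[int]_n, k = map_mx intr z &
  (map_mx intr z *m invmx Q *m (map_mx intr z)^T) 0 0 = 1 :> R.
have mapz (z : 'rV[int]_n) :
    map_mx ratr (map_mx intr z : 'rV[rat]_n) = map_mx intr z :> 'rV[R]_n.
  by apply/rowP => i; rewrite !mxE ratr_int.
have [k [z -> zQ]|H HY|S [m [clS SQ Sm Sdep]]] := @gram_field R n Q A Y n_gt0 A_unit QE.
- by rewrite mapz.
(* A form [H] in lattice coordinates is [L^T *m H *m L] in Euclidean ones, and the trace of the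
   latter is that of [H *m gram L]. *)
- have : \tr (L^T *m H *m L) = 0.
    apply: (immersed_torus_trace n_gt0 L_unit immersed) => z zz.
    rewrite freq_quad; have := HY (map_mx intr z); rewrite mapz => -> //; first by rewrite mulr0.
    exists z => //; rewrite invQ -scalemxAr -scalemxAl mxE.
    move: zz; rewrite /dot.
    have LL : L^T *m ((invmx L)^T *m invmx L) *m L = 1%:M.
      by rewrite mulmxA -trmx_mul mulVmx // trmx1 mul1mx mulVmx.
    rewrite -[X in X *m _]mulmx1 -LL.
    rewrite freq_quad => zz.
    by rewrite /mu invf_div mulrAC zz divff // pnatr_eq0 -lt0n.
  rewrite -mulmxA mxtrace_mulC -mulmxA => trH.
  by rewrite /Q -scalemxAr linearZ /= /gram trH mulr0.
- exists S, m; split=> // i j; by have := SQ i j; rewrite mxE.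
Qed.

End TorusField.

Unset Implicit Arguments.

Theorem theorem2 (R : realType) (n : nat) (n_gt0 : (0 < n)%N) (L : 'M[R]_n)
    (L_basis : L \in unitmx)
    (immersed : exists (m : nat) (f : torus L -> 'rV[R]_m.+1),
        minimal_isometric_immersion f) :
  let q := gram L in
  let o := Ordinal n_gt0 in
  let K := generated_subfield
    [set q ij.1 ij.2 / q o o | ij in [set: 'I_n * 'I_n]] in
  exists d : nat, has_degree K d /\
    (d <= n.-1 ^ ((n.-1 * (n + 2)) %/ 4))%N.
Proof.
move=> q o K.
have [S [m [clS Sq mb Sdep]]] := torus_gram_field n_gt0 L_basis immersed.
set mu := (n%:R / (2 * pi) ^+ 2 : R) in Sq.
have mu0 : mu != 0.
  by rewrite mulf_neq0 ?invr_neq0 ?expf_neq0 ?mulf_neq0 ?pnatr_eq0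
    -?lt0n // gt_eqF // pi_gt0.
pose ratio (ij : 'I_n * 'I_n) := q ij.1 ij.2 / q o o.
pose K' : {pred R} := fun x => `[< K x >].
have K'P x : reflect (K x) (x \in K') by exact: asboolP.
have clK : divring_closed K'.
  split.
  - by apply/K'P => T [T1 _ _] _.
  - move=> x y /K'P Kx /K'P Ky; apply/K'P => T clT AT; have [_ TB _] := clT.
    by apply: TB; [exact: Kx|exact: Ky].
  - move=> x y /K'P Kx /K'P Ky; apply/K'P => T clT AT; have [_ _ TV] := clT.
    by apply: TV; [exact: Kx|exact: Ky].
(* The factor [mu] cancels in the ratios, so [K'] is contained in [S]. Dependence of any [m.+1]
   elements is inherited by subsets, so the degree bound passes from [S] to [K']. *)
have KS : {subset K' <= S}.
  move=> x /K'P; apply=> // _ [[i j] _ <-] /=.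
  have [_ _ SV] := clS.
  have := SV _ _ (Sq i j) (Sq o o).
  by rewrite -mulf_div divff // mul1r.
have sK : {subset [seq ratio ij | ij <- enum {: 'I_n * 'I_n}] <= K'}.
  by move=> _ /mapP[ij _ ->]; apply/K'P => T clT; apply; exists ij.
have [|y Ky|E [iota [iotaK dimE]]] := @finite_extension R K' m _ clK sK.
- move=> T clT sT x /K'P; apply=> // _ [ij _ <-].
  by apply: sT; apply/mapP; exists ij; rewrite ?mem_enum.
- by apply: Sdep => i; apply: KS.
exists (\dim {: E}); split; last exact: leq_trans mb.
exists E, iota; split=> //; apply/seteqP; split=> [_ [e _ <-]|x Kx].
  by apply/K'P/iotaK; exists e.
by have /K'P/iotaK[e <-] := Kx; exists e.
Qed.
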